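(* Let $-\infty<a<b<\infty$ and let $f:\mathbb{R}\to\mathbb{R}$ be such that $f$ is of bounded variation on $[a,b]$, $f\in L^1((-\infty,a])$ and $f\in L^1([b,\infty))$. Let $x\in(a,b)$. Then $$\frac{f(x-)+f(x+)}{2}=\frac{1}{2\pi}\lim_{T\to\infty}\int_{-T}^{T}e^{ixs}\int_a^b e^{-ist}f(t)\,dt\,ds$$ and $$\lim_{\substack{B\to\infty\\ A\to-\infty}}\int_A^B e^{ixs}\int_{-\infty}^{\infty}e^{-ist}f(t)\chi_{(-\infty,a]\cup[b,\infty)}(t)\,dt\,ds=0.$$
   Context: $f(x-)$ and $f(x+)$ denote the left and right limits of $f$ at $x$, and $\chi_E$ is the characteristic function of the set $E$. In the last limit $A\to-\infty$ and $B\to\infty$ independently. *)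

(* Defs.v *)
From HB Require Import structures.
From mathcomp Require Import all_boot all_order all_algebra.
From mathcomp Require Import complex.
From mathcomp Require Import all_classical all_reals all_analysis.

Set Implicit Arguments.
Unset Strict Implicit.
Unset Printing Implicit Defensive.

Import Order.TTheory GRing.Theory Num.Theory.
Import numFieldNormedType.Exports.

Local Open Scope classical_set_scope.
Local Open Scope ring_scope.

(* Measurability and integrals are taken with respect to the completed measure,
   on the Lebesgue (Caratheodory) sigma-algebra: the library's
   [lebesgue_measure] lives on the Borel sets only. *)
Definition Leb (R : realType) := @completed_lebesgue_measure R.

Definition in_L1 (R : realType) (D : set R) (f : R -> R) : Prop :=
  (@Leb R).-integrable D (EFin \o f).

Definition expi (R : realType) (y : R) : R[i] := Complex (cos y) (sin y).

Definition cintegral (R : realType) (D : set R) (F : R -> R[i]) : R[i] :=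
  Complex (\int[@Leb R]_(t in D) complex.Re (F t))
          (\int[@Leb R]_(t in D) complex.Im (F t)).

Notation "\cint_ ( t 'in' D ) F" := (cintegral D (fun t => F))
  (at level 36, F at level 36, t at level 50,
   format "\cint_ ( t  'in'  D )  F") : ring_scope.

(* Main.v *)
Require Import Defs.
From HB Require Import structures.
From mathcomp Require Import all_boot all_order all_algebra.
From mathcomp Require Import complex.
From mathcomp Require Import all_classical all_reals all_analysis.
From mathcomp Require Import measurable_realfun.
From mathcomp Require Import ring lra.
Import Order.TTheory GRing.Theory Num.Theory.
Import numFieldNormedType.Exports.
Local Open Scope classical_set_scope.
Local Open Scope ring_scope.

Set Implicit Arguments.
Unset Strict Implicit.

(** Both limits come from one exchange of integrals followed by one analytic
    fact.  For [g] integrable on [D], Fubini turns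
    [\cint_(s in [A, B]) e^(ixs) \cint_(t in D) e^(-ist) g(t)] into the integral
    over [t] in [D] of [g(t)] against the integral of [e^(i(x-t)s)] over
    [s] in [A, B] (lemma [cintegral_exchange]).

    For the part of [f] outside [(a, b)], the inner integral is a difference of
    two bounded oscillations divided by [x - t], and [x - t] stays away from [0].
    So the limit [0] is the Riemann-Lebesgue lemma for the integrable function
    [f(t) / (x - t)] ([riemann_lebesgue], [tail_oscillation]).  The lemma is
    proved uniformly in the phase of the oscillation, which makes it insensitive
    to the centre [x]: intervals are explicit, Borel sets follow from them by
    Dynkin induction, completed Lebesgue sets differ from Borel sets by null
    sets, and simple functions are dense in L1.

    For the part on [[a, b]], taken over [-T, T], the imaginary part vanishes by
    parity and the real part is twice the integral of [f(t)] against the kernel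
    [sin(T(x-t))/(x-t)].  By the Jordan decomposition it suffices to treat a
    nondecreasing [h].  Writing [h(t)] as [h(a)] plus the measure of the levels
    [y] in [h(a), h(b)] below [h(t)], and exchanging integrals, reduces the
    problem to the indicator functions of the superlevel sets of [h].  Those are
    intervals [[v, b]] up to their left endpoint, and on them the kernel
    integrates to [S(b - x) + S(x - v)], where [S(c)], the integral of
    [sin(cs)/s] over [0, T], is bounded and tends to [sgn(c) pi/2]
    ([sine_integral_bound], [sine_integral_cvg]).  The limit of a slice is thus
    [pi], [pi/2] or [0] according to whether [v] is smaller than, equal to or
    larger than [x], that is, for almost every [y], according to the position of
    [y] relative to [h(x-)] and [h(x+)].  Dominated convergence in the level [y]
    then yields [pi/2 (h(x-) + h(x+))]
    ([dirichlet_jordan_nondecreasing], [dirichlet_jordan]). *)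

(** * Lebesgue sets and Borel sets *)

(** The real line with the sigma-algebra on which [Leb] is defined. *)
Notation LebT R := (caratheodory_type
  (R := R) (T := ocitv_type R) (measure_extension.mu_ext (@wlength R idfun))).

Section lebesgue_transfer.
Context {R : realType}.
Local Notation mu := (@Leb R).

Lemma Leb_measurable (A : set R) :
  measurable (A : set (measurableTypeR R)) -> measurable (A : set (LebT R)).
Proof. by move=> mA; exact: (@sub_caratheodory _ _ R (@wlength R idfun) A mA). Qed.

Lemma Leb_measurable_itv (i : interval R) : measurable ([set` i] : set (LebT R)).
Proof. by apply: Leb_measurable; exact: measurable_itv. Qed.

Lemma Leb_id_measurable :
  measurable_fun setT (idfun : LebT R -> measurableTypeR R).
Proof. by move=> _ A mA; rewrite setTI; exact: Leb_measurable. Qed.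

Lemma measurable_fun_Leb d (U : measurableType d) (f : R -> U) (D : set R) :
  measurable_fun (setT : set (measurableTypeR R)) f ->
  measurable_fun (D : set (LebT R)) f.
Proof.
move=> mf; apply: measurable_funTS.
exact: (measurableT_comp mf Leb_id_measurable).
Qed.

Lemma Leb_continuous_measurable (f : R -> R) (D : set R) :
  continuous f -> measurable_fun (D : set (LebT R)) f.
Proof. by move=> cf; apply: measurable_fun_Leb; exact: continuous_measurable_fun. Qed.

Lemma LebE (A : set R) : mu A = lebesgue_measure A.
Proof. by []. Qed.

Lemma Leb_itv (a b : R) : a <= b -> mu `[a, b] = (b - a)%:E.
Proof.
move=> ab; rewrite LebE lebesgue_measure_itv/= lte_fin.
by case: ltgtP ab => // -> _; rewrite subrr.
Qed.

(** [lebesgue_measure] is the pushforward of the completed measure along the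
    identity, seen as a measurable map from Lebesgue sets to Borel sets. *)
Lemma integral_Leb (D : set R) (f : R -> \bar R) :
  measurable (D : set (measurableTypeR R)) ->
  measurable_fun (setT : set (measurableTypeR R)) f ->
  (\int[mu]_(x in D) f x = \int[lebesgue_measure]_(x in D) f x)%E.
Proof.
move=> mD mf.
rewrite [LHS]integralE [RHS]integralE.
have pE (g : R -> \bar R) : measurable_fun (setT : set (measurableTypeR R)) g ->
  (forall x, 0 <= g x)%E ->
  (\int[mu]_(x in D) g x = \int[lebesgue_measure]_(x in D) g x)%E.
  move=> mg g0.
  rewrite -(ge0_integral_pushforward Leb_id_measurable mu mD)//.
  exact: measurable_funTS.
by rewrite !pE//; [exact: measurable_funeneg|exact: measurable_funepos].
Qed.

Lemma Rintegral_Leb (D : set R) (f : R -> R) :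
  measurable (D : set (measurableTypeR R)) ->
  measurable_fun (setT : set (measurableTypeR R)) f ->
  \int[mu]_(x in D) f x = \int[lebesgue_measure]_(x in D) f x.
Proof.
move=> mD mf; rewrite /Rintegral integral_Leb//.
exact/measurable_EFinP.
Qed.

Lemma Rintegral_Leb_FTC2 (F f : R -> R) (a b : R) : a <= b ->
  continuous f -> (forall x : R, is_derive x 1 F (f x)) ->
  \int[mu]_(x in `[a, b]) f x = F b - F a.
Proof.
move=> ab cf dF.
rewrite Rintegral_Leb//; last exact: continuous_measurable_fun.
move: ab; rewrite le_eqVlt => /predU1P[->|ab].
  by rewrite set_itv1 Rintegral_set1 subrr.
have cF : continuous F.
  move=> x; apply: differentiable_continuous; apply/derivable1_diffP.
  exact: ex_derive.
rewrite /Rintegral (@continuous_FTC2 _ f F)//.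
- by apply: continuous_subspaceT => x; exact: cf.
- split.
  + by move=> x _; exact: ex_derive.
  + by apply: cvg_at_right_filter; exact: cF.
  + by apply: cvg_at_left_filter; exact: cF.
- by move=> x _; rewrite derive1E; apply: derive_val.
Qed.

End lebesgue_transfer.

(** * Integrability and Fubini's theorem for bounded kernels *)

Section integral_tools.
Context d (T : measurableType d) (R : realType).
Variable m : {measure set T -> \bar R}.

Lemma integrable_mulr_bounded (D : set T) (f g : T -> R) (M : R) :
  measurable D -> m.-integrable D (EFin \o f) -> measurable_fun D g ->
  (forall x, D x -> `|g x| <= M) -> m.-integrable D (EFin \o (fun x => f x * g x)).
Proof.
move=> mD fi mg gM.
apply: (@integrableMl _ _ _ m D mD (EFin \o f) g fi mg).
exists M; split; first exact: num_real.
by move=> y My x Dx; exact: le_trans (gM _ Dx) (ltW My).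
Qed.

Lemma integrable_bounded (D : set T) (g : T -> R) (M : R) :
  measurable D -> (m D < +oo)%E -> measurable_fun D g ->
  (forall x, D x -> `|g x| <= M) -> m.-integrable D (EFin \o g).
Proof.
move=> mD fD mg gM; apply: measurable_bounded_integrable => //.
exists M; split; first exact: num_real.
by move=> y My x Dx; exact: le_trans (gM _ Dx) (ltW My).
Qed.

Lemma Rintegral_le_bound (D : set T) (f g : T -> R) :
  measurable D -> m.-integrable D (EFin \o f) -> m.-integrable D (EFin \o g) ->
  (forall x, D x -> `|f x| <= g x) -> `|\int[m]_(x in D) f x| <= \int[m]_(x in D) g x.
Proof.
move=> mD fi gi fg; apply: le_trans (le_normr_Rintegral mD fi) _.
by apply: le_Rintegral => //; exact: integrable_norm.
Qed.

Lemma integrable_restrict (D : set T) (f : T -> R) : measurable D ->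
  m.-integrable D (EFin \o f) -> m.-integrable setT (EFin \o (fun x => f x * \1_D x)).
Proof.
move=> mD fi.
suff -> : EFin \o (fun x => f x * \1_D x) = (EFin \o f) \_ D.
  exact: (integrable_mkcond _ mD).1.
apply/funext => x /=; rewrite patchE indicE.
by case: ifPn => _; rewrite ?mulr1 ?mulr0.
Qed.

Lemma Rintegral_indic (D : set T) (f : T -> R) :
  \int[m]_(x in D) f x = \int[m]_x (f x * \1_D x).
Proof.
rewrite Rintegral_mkcond; apply: eq_Rintegral => x _.
by rewrite patchE indicE; case: ifPn => _; rewrite ?mulr1 ?mulr0.
Qed.

End integral_tools.

Section lebesgue_tools.
Context {R : realType}.
Local Notation mu := (@Leb R).

Lemma measurable_inv_real :
  measurable_fun (setT : set (measurableTypeR R)) (fun u : R => u^-1).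
Proof.
rewrite -(setvU [set (0 : R)]); apply/measurable_funU.
- exact: measurableC.
- exact: measurable_set1.
- split; last exact: measurable_fun_set1.
  apply: open_continuous_measurable_fun.
    by apply: closed_openC; exact: closed_eq.
  move=> u; rewrite inE/= => /eqP u0.
  exact: inv_continuous.
Qed.

Lemma Leb_itv_fin (a b : R) : (mu `[a, b] < +oo)%E.
Proof.
have [ab|ba] := leP a b; first by rewrite Leb_itv// ltry.
by rewrite set_itv_ge ?bnd_simp -?ltNge// LebE measure0.
Qed.

Lemma Rintegral_Leb_cst (a b r : R) : a <= b ->
  \int[mu]_(t in `[a, b]) r = r * (b - a).
Proof.
move=> ab; rewrite Rintegral_cst; last exact: Leb_measurable_itv.
by congr (r * _); exact: (congr1 fine (Leb_itv ab)).
Qed.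

Lemma Leb_integrable_bounded_itv (a b M : R) (f : R -> R) :
  measurable_fun (`[a, b] : set (LebT R)) f ->
  (forall t, a <= t <= b -> `|f t| <= M) ->
  mu.-integrable `[a, b] (EFin \o f).
Proof.
move=> mf fM; apply: (@integrable_bounded _ _ _ mu `[a, b] f M) => //.
- exact: Leb_measurable_itv.
- exact: Leb_itv_fin.
Qed.

Lemma Leb_integrable_continuous_itv (a b : R) (f : R -> R) :
  continuous f -> mu.-integrable `[a, b] (EFin \o f).
Proof.
move=> cf.
have cf' : {within `[a, b], continuous f} by exact: continuous_subspaceT.
have /compact_bounded[M [_ hM]] : compact (f @` `[a, b]).
  apply: continuous_compact => //; exact: segment_compact.
apply: (@Leb_integrable_bounded_itv _ _ (M + 1)).
  exact: Leb_continuous_measurable.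
by move=> t abt; apply: hM; rewrite ?ltrDl//=; exists t.
Qed.

Lemma Rintegral_eq_off_point (D : set R) (x : R) (f g : R -> R) :
  measurable (D : set (LebT R)) ->
  measurable_fun (D : set (LebT R)) f -> measurable_fun (D : set (LebT R)) g ->
  (forall t, D t -> t != x -> f t = g t) ->
  \int[mu]_(t in D) f t = \int[mu]_(t in D) g t.
Proof.
move=> mD mf mg fg; congr fine; apply: (@ae_eq_integral _ _ _ mu D _ _ mD).
- exact/measurable_EFinP.
- exact/measurable_EFinP.
- exists [set x]; split.
  + by apply: Leb_measurable; exact: measurable_set1.
  + exact: (@lebesgue_measure_set1 R x).
  + move=> t /= ft; apply: contrapT => tx; apply: ft => Dt.
    by rewrite fg//; exact/eqP.
Qed.

End lebesgue_tools.

Section fubini_bounded.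
Context d1 d2 (T1 : measurableType d1) (T2 : measurableType d2) (R : realType).
Variable m1 : {sigma_finite_measure set T1 -> \bar R}.
Variable m2 : {sigma_finite_measure set T2 -> \bar R}.

(** Extending [g] and [k] by zero outside [D1] and [D2] gives a function
    dominated by [|g(x)| M \1_D2(y)], which is integrable on the product, and all
    of whose sections are integrable, so that no exceptional null set remains.
    The measurability of the inner integral is what dominated convergence and
    almost-everywhere comparisons require later. *)
Lemma Rintegral_fubini_bounded (D1 : set T1) (D2 : set T2) (g : T1 -> R)
    (k : T1 * T2 -> R) (M : R) :
  measurable D1 -> measurable D2 -> (m2 D2 < +oo)%E ->
  m1.-integrable D1 (EFin \o g) -> measurable_fun setT k ->
  (forall x y, D1 x -> D2 y -> `|k (x, y)| <= M) ->
  \int[m1]_(x in D1) (g x * \int[m2]_(y in D2) k (x, y)) =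
    \int[m2]_(y in D2) \int[m1]_(x in D1) (g x * k (x, y)) /\
  measurable_fun D2 (fun y => \int[m1]_(x in D1) (g x * k (x, y))).
Proof.
move=> mD1 mD2 fD2 gi mk kM.
pose G x := g x * \1_D1 x.
pose h (z : T1 * T2) := G z.1 * (k z * \1_D2 z.2).
have Gi : m1.-integrable setT (EFin \o G) by exact: integrable_restrict.
have mG : measurable_fun setT G by exact/measurable_EFinP/(measurable_int m1).
have mh : measurable_fun setT h.
  apply: measurable_funM; first exact: (measurableT_comp mG measurable_fst).
  apply: measurable_funM => //.
  apply: (measurableT_comp _ measurable_snd).
  exact: measurable_indic.
have hM x y : D1 x -> `|k (x, y) * \1_D2 y| <= M * \1_D2 y.
  move=> Dx; rewrite indicE; case: (boolP (y \in D2)) => [|_].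
    by rewrite inE !mulr1; exact: kM.
  by rewrite !mulr0 normr0.
have hM' x y : `|h (x, y)| <= `|G x| * (M * \1_D2 y).
  rewrite normrM /= /G indicE; case: (boolP (x \in D1)) => [|_].
    by rewrite inE mulr1 => Dx; apply: ler_wpM2l => //; exact: hM.
  by rewrite !mulr0 normr0 !mul0r.
have Mi : m2.-integrable setT (EFin \o (fun y => M * \1_D2 y)).
  apply: (integrable_restrict mD2 (f := fun=> M)).
  by apply: (integrable_bounded (M := `|M|)) => //; exact: measurable_cst.
have h2i x : m2.-integrable setT (fun y => (h (x, y))%:E).
  apply: (le_integrable measurableT _ _
    (integrableZl measurableT `|G x| Mi)).
    exact/measurable_EFinP/(measurableT_comp mh (pair1_measurable x)).
  move=> y _ /=; rewrite lee_fin.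
  by apply: le_trans (hM' x y) _; exact: ler_norm.
have h1i y : m1.-integrable setT (fun x => (h (x, y))%:E).
  apply: (le_integrable measurableT _ _
    (integrableZl measurableT (M * \1_D2 y) (integrable_norm Gi))).
    exact/measurable_EFinP/(measurableT_comp mh (pair2_measurable y)).
  move=> x _ /=; rewrite lee_fin mulrC.
  by apply: le_trans (hM' x y) _; exact: ler_norm.
have hi : (m1 \x m2)%E.-integrable setT (EFin \o h).
  apply/integrable12ltyP; first exact/measurable_EFinP.
  have := integrableZl measurableT (\int[m2]_y (M * \1_D2 y)) (integrable_norm Gi).
  move/integrableP => [_]; apply: le_lt_trans.
  apply: ge0_le_integral => //=.
  - by move=> x _; exact: integral_ge0.
  - apply: (measurable_fun_fubini_tonelli_F (fun z => `|h z|%:E)) => //.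
    by apply/measurable_EFinP; exact: measurableT_comp.
  - apply/measurable_EFinP/measurableT_comp => //; apply: measurable_funM => //.
    exact: measurableT_comp.
  - move=> x _.
    apply: (@le_trans _ _ (\int[m2]_y (`|G x| * (M * \1_D2 y))%:E)%E).
      apply: ge0_le_integral => //=.
      + exact/measurable_EFinP/measurableT_comp/(measurableT_comp mh (pair1_measurable x)).
      + apply/measurable_EFinP/measurable_funM => //.
        exact/measurable_EFinP/(measurable_int m2).
      + by move=> y _; rewrite lee_fin.
    rewrite (_ : (\int[m2]_y _)%E = (`|G x| * \int[m2]_y (M * \1_D2 y))%:E); last first.
      rewrite -RintegralZl// /Rintegral fineK//.
      apply: integrable_fin_num => //.
      exact: (integrableZl measurableT `|G x| Mi).
    by rewrite lee_fin mulrC; exact: ler_norm.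
have innerE y : D2 y ->
    \int[m1]_(x in D1) (g x * k (x, y)) = \int[m1]_x h (x, y).
  move=> Dy; rewrite Rintegral_indic; apply: eq_Rintegral => x _.
  by rewrite /h /G /= [\1_D2 y]indicE mem_set// mulr1 mulrAC.
split; last first.
  apply: (eq_measurable_fun (fine \o fubini_G m1 (EFin \o h))).
    by move=> y; rewrite inE => Dy; rewrite innerE.
  apply: measurable_funTS; apply: measurableT_comp => //.
  exact: measurable_fubini_G hi.
transitivity (\int[m1]_x \int[m2]_y h (x, y)).
  rewrite Rintegral_indic; apply: eq_Rintegral => x _.
  rewrite mulrAC Rintegral_indic -/(G x).
  have [Dx|Dx] := pselect (D1 x); last first.
    have G0 : G x = 0 by rewrite /G indicE memNset// mulr0.
    rewrite G0 mul0r; under [RHS]eq_Rintegral do rewrite /h /= G0 mul0r.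
    by rewrite Rintegral_cst// mul0r.
  rewrite -RintegralZl//=.
  apply: (le_integrable measurableT _ _ Mi) => /=.
    apply/measurable_EFinP/measurable_funM => //.
    exact: (measurableT_comp mk (pair1_measurable x)).
  move=> y _; rewrite lee_fin; apply: le_trans (hM x y Dx) _; exact: ler_norm.
transitivity (\int[m2]_y \int[m1]_x h (x, y)).
  have := Fubini hi.
  rewrite /Rintegral => E; congr fine.
  under eq_integral do rewrite fineK ?(integrable_fin_num measurableT (h2i _))//.
  under [RHS]eq_integral do rewrite fineK ?(integrable_fin_num measurableT (h1i _))//.
  exact: E.
rewrite [RHS]Rintegral_indic; apply: eq_Rintegral => y _.
have [Dy|Dy] := pselect (D2 y).
  by rewrite innerE// indicE mem_set// mulr1.
rewrite [in RHS]indicE memNset// mulr0.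
under eq_Rintegral do rewrite /h /= [X in _ * (_ * X)]indicE memNset// !mulr0.
by rewrite Rintegral_cst// mul0r.
Qed.

End fubini_bounded.

(** * The Riemann-Lebesgue lemma *)

Section riemann_lebesgue.
Context {R : realType}.
Local Notation mu := (@Leb R).
Implicit Types (k : R -> R) (s p : R).

(** The bound [M] may not depend on the phase [p].  Translating the variable of
    a frequency-[s] oscillation by [x] changes its phase by [s x], so this
    uniformity covers every centre at once, and both sine and cosine. *)
Definition vanishing_oscillation k := mu.-integrable setT (EFin \o k) /\
  forall e, 0 < e -> exists M, forall s p, M <= `|s| ->
    `|\int[mu]_t (k t * cos (s * t + p))| <= e.

Lemma continuous_cos_affine s p : continuous (fun t : R => cos (s * t + p)).
Proof.
move=> t; apply: (@continuous_comp _ _ _ (fun u => s * u + p) cos); last exact: continuous_cos.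
by apply: cvgD; [apply: cvgMr; exact: cvg_id|exact: cvg_cst].
Qed.

Lemma is_derive_sin_affine p s : s != 0 -> forall t : R,
  is_derive t 1 (fun u => sin (s * u + p) / s) (cos (s * t + p)).
Proof.
move=> s0 t.
have h1 : is_derive t 1 (fun u : R => s * u + p) s.
  by apply: is_derive_eq; rewrite /GRing.scale/=; ring.
have h2 := @is_derive1_comp R sin (fun u : R => s * u + p) t _ _ (is_derive_sin _) h1.
have h3 := is_deriveM h2 (is_derive_cst s^-1 t 1).
suff -> : cos (s * t + p) = (sin \o (fun u : R => s * u + p)) t *: 0 +
  cst s^-1 t *: (cos (s * t + p) * s) by exact: h3.
by rewrite scaler0 add0r /GRing.scale/=; field.
Qed.

Lemma normr_cos_le1 (y : R) : `|cos y| <= 1.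
Proof. by rewrite ler_norml cos_geN1 cos_le1. Qed.

Lemma integrable_osc k s p : mu.-integrable setT (EFin \o k) ->
  mu.-integrable setT (EFin \o (fun t => k t * cos (s * t + p))).
Proof.
move=> ki; apply: (@integrable_mulr_bounded _ _ _ mu setT k _ 1 measurableT ki).
  by apply: Leb_continuous_measurable; exact: continuous_cos_affine.
by move=> t _; exact: normr_cos_le1.
Qed.

(** An oscillating factor is bounded by [1], so an L1 error of [e/2] in the
    function costs at most [e/2] in the oscillating integral, at every frequency
    and phase: the property is closed under L1 approximation. *)
Lemma vanishing_oscillation_approx k : mu.-integrable setT (EFin \o k) ->
  (forall e, 0 < e -> exists2 k', vanishing_oscillation k' &
    \int[mu]_t `|k t - k' t| <= e) ->
  vanishing_oscillation k.
Proof.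
move=> ki happrox; split => // e e0.
have e2 : 0 < e / 2 by rewrite divr_gt0.
have [k' [k'i /(_ _ e2)[M hM]] kk'] := happrox _ e2.
exists M => s p Ms.
have di : mu.-integrable setT (EFin \o (fun t => k t - k' t)).
  by rewrite (_ : EFin \o _ = (EFin \o k) \- (EFin \o k'))%E//; exact: integrableB.
rewrite (_ : \int[mu]_t _ = \int[mu]_t ((k t - k' t) * cos (s * t + p)) +
    \int[mu]_t (k' t * cos (s * t + p))); last first.
  rewrite -RintegralD//; [|exact: integrable_osc|exact: integrable_osc].
  by apply: eq_Rintegral => t _; rewrite mulrBl subrK.
rewrite (splitr e); apply: le_trans (ler_normD _ _) _; apply: lerD; last exact: hM.
apply: le_trans kk'; apply: Rintegral_le_bound => //.
- exact: integrable_osc.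
- exact: integrable_norm.
- by move=> t _; rewrite normrM ler_piMr// normr_cos_le1.
Qed.

Lemma vanishing_oscillation0 : vanishing_oscillation (fun=> 0).
Proof.
split; first exact: integrable0.
move=> e e0; exists 0 => s p _.
under eq_Rintegral do rewrite mul0r.
by rewrite Rintegral_cst// mul0r normr0 ltW.
Qed.

Lemma vanishing_oscillationD k1 k2 : vanishing_oscillation k1 ->
  vanishing_oscillation k2 -> vanishing_oscillation (fun t => k1 t + k2 t).
Proof.
move=> [i1 h1] [i2 h2]; split.
  by rewrite (_ : EFin \o _ = (EFin \o k1) \+ (EFin \o k2))%E//; exact: integrableD.
move=> e e0; have e2 : 0 < e / 2 by rewrite divr_gt0.
have [M1 hM1] := h1 _ e2; have [M2 hM2] := h2 _ e2.
exists (Num.max M1 M2) => s p; rewrite ge_max => /andP[M1s M2s].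
rewrite (_ : \int[mu]_t _ = \int[mu]_t (k1 t * cos (s * t + p)) +
    \int[mu]_t (k2 t * cos (s * t + p))); last first.
  rewrite -RintegralD//; [|exact: integrable_osc|exact: integrable_osc].
  by apply: eq_Rintegral => t _; rewrite mulrDl.
by rewrite (splitr e); apply: le_trans (ler_normD _ _) _; apply: lerD; auto.
Qed.

Lemma vanishing_oscillationZ c k : vanishing_oscillation k ->
  vanishing_oscillation (fun t => c * k t).
Proof.
move=> [ki h]; split; first exact: (integrableZl measurableT c ki).
move=> e e0; have ec : 0 < e / (`|c| + 1) by rewrite divr_gt0// ltr_wpDl.
have [M hM] := h _ ec; exists M => s p Ms.
under eq_Rintegral do rewrite -mulrA.
rewrite RintegralZl//; last exact: integrable_osc.
rewrite normrM; apply: le_trans (ler_wpM2l (normr_ge0 c) (hM s p Ms)) _.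
rewrite mulrA ler_pdivrMr ?ltr_wpDl// mulrC ler_wpM2l ?(ltW e0)//.
by rewrite lerDl.
Qed.

Lemma vanishing_oscillation_dominated (k_ : nat -> R -> R) k (g : R -> R) :
  (forall n, vanishing_oscillation (k_ n)) ->
  mu.-integrable setT (EFin \o g) ->
  (forall n t, `|k_ n t| <= g t) ->
  (forall t, k_ ^~ t @ \oo --> k t) -> vanishing_oscillation k.
Proof.
move=> hk gi kg kk.
have mk_ n : measurable_fun (setT : set (LebT R)) (k_ n).
  by have [/(measurable_int mu)/measurable_EFinP] := hk n.
have mk : measurable_fun (setT : set (LebT R)) k.
  by apply: (measurable_fun_cvg mk_) => t _; exact: kk.
have [|||||] := @dominated_convergence _ _ _ mu setT measurableT
   (fun n => EFin \o k_ n) (EFin \o k) (EFin \o g).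
- by move=> n; exact/measurable_EFinP.
- exact/measurable_EFinP.
- by apply: aeW => t _; apply: cvg_EFin; [exact: nearW|exact: kk].
- exact: gi.
- by apply: aeW => t n _; rewrite /= lee_fin.
move=> ki dk _.
apply: vanishing_oscillation_approx => // e e0.
have /fine_cvgP[_ /cvgrPdist_le/(_ _ e0)[N _ /(_ N (leqnn N))]] := dk.
rewrite sub0r normrN => hN; exists (k_ N); first exact: hk.
apply: le_trans hN; apply: le_trans (ler_norm _).
rewrite /= le_eqVlt; apply/orP; left; apply/eqP.
by apply: eq_Rintegral => t _; rewrite /= distrC.
Qed.

Lemma vanishing_oscillation_itv (a b : R) :
  vanishing_oscillation \1_`]a, b].
Proof.
have [ab|ba] := leP a b; last first.
  rewrite (_ : \1_`]a, b] = fun=> 0); first exact: vanishing_oscillation0.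
  apply/funext => t; rewrite indicE memNset//= in_itv/= => /andP[at_ tb].
  by have := lt_trans ba (lt_le_trans at_ tb); rewrite ltxx.
have ii : mu.-integrable setT (EFin \o (\1_`]a, b] : R -> R)).
  rewrite (_ : \1_`]a, b] = fun t => 1 * \1_`]a, b] t); last first.
    by apply/funext => t; rewrite mul1r.
  apply: (@integrable_restrict _ _ _ mu _ (fun=> 1)); first exact: Leb_measurable_itv.
  apply: (integrable_bounded (M := 1)).
  - exact: Leb_measurable_itv.
  - apply: (@le_lt_trans _ _ (mu `[a, b])); last by rewrite Leb_itv// ltry.
    apply: le_measure; rewrite ?inE; try exact: Leb_measurable_itv.
    exact: subset_itv_oc_cc.
  - exact: measurable_cst.
  - by move=> t _; rewrite normr1.
split => // e e0; exists (2 / e) => s p Ms.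
have s0 : s != 0 by rewrite -normr_gt0 (lt_le_trans _ Ms)// divr_gt0.
under eq_Rintegral do rewrite mulrC.
rewrite -Rintegral_indic Rintegral_Leb//; last first.
  by apply: continuous_measurable_fun; exact: continuous_cos_affine.
rewrite Rintegral_itv_obnd_cbnd; last first.
  apply: (@integrableS _ _ _ lebesgue_measure `[a, b]) => //.
    exact: subset_itv_oc_cc.
  apply: continuous_compact_integrable; first exact: segment_compact.
  by apply: continuous_subspaceT; exact: continuous_cos_affine.
rewrite -Rintegral_Leb//; last first.
  by apply: continuous_measurable_fun; exact: continuous_cos_affine.
rewrite (Rintegral_Leb_FTC2 ab (@continuous_cos_affine s p)
  (is_derive_sin_affine p s0)).
rewrite -mulrBl normrM normfV ler_pdivrMr ?normr_gt0//.
apply: (@le_trans _ _ 2); last by rewrite mulrC -ler_pdivrMr.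
apply: le_trans (ler_normB _ _) _; rewrite -[2]/(1 + 1).
by apply: lerD; rewrite ler_norml sin_geN1 sin_le1.
Qed.

End riemann_lebesgue.

Section riemann_lebesgue_L1.
Context {R : realType}.
Local Notation mu := (@Leb R).
Implicit Types (k : R -> R) (s p : R).

Lemma vanishing_oscillation_sum (I : Type) (r : seq I) (F : I -> R -> R) :
  (forall i, vanishing_oscillation (F i)) ->
  vanishing_oscillation (fun t => \sum_(i <- r) F i t).
Proof.
move=> hF; elim: r => [|i r ih].
  under eq_fun do rewrite big_nil; exact: vanishing_oscillation0.
by under eq_fun do rewrite big_cons; exact: vanishing_oscillationD.
Qed.

Lemma indic_le1 (T : Type) (A : set T) (t : T) : `|\1_A t| <= 1 :> R.
Proof. by rewrite indicE; case: (_ \in _); rewrite ?normr1 ?normr0. Qed.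

Lemma cvg_indic_bigcup (F : nat -> set R) (t : R) :
  \1_(\big[setU/set0]_(i < n) F i) t @[n --> \oo] --> (\1_(\bigcup_i F i) t : R).
Proof.
apply: (@cvg_near_cst _ _ _ _ _ _).
have [[i _ Fit]|nF] := pselect ((\bigcup_i F i) t).
  exists i.+1 => // n /= iltn.
  rewrite !indicE !mem_set//; first by exists i.
  by rewrite -bigcup_mkord; exists i.
near=> n; rewrite !indicE !memNset//.
by rewrite -bigcup_mkord => -[i _ Fit]; apply: nF; exists i.
Unshelve. all: by end_near. Qed.

(** Dynkin induction from the half-open intervals.  Cutting with a bounded
    interval keeps complements integrable and supplies the dominating function
    for countable disjoint unions. *)
Lemma vanishing_oscillation_borel_bounded (A : set R) (N : R) :
  measurable (A : set (measurableTypeR R)) ->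
  vanishing_oscillation \1_(A `&` `]- N, N]).
Proof.
move=> mA.
pose P (B : set (measurableTypeR R)) :=
  vanishing_oscillation (\1_((B : set R) `&` `]- N, N]) : R -> R).
suff : P A by [].
apply: (@dynkin_induction _ (measurableTypeR R) (@ocitv R) P) => //.
- exact: ocitvI.
- rewrite /P setTI; exact: vanishing_oscillation_itv.
- move=> B oB.
  have : ocitv (B `&` `]- N, N]) by apply: ocitvI => //; exists (- N, N).
  by rewrite /P => -[[c d] _ <-]; exact: vanishing_oscillation_itv.
- move=> B _ PB; rewrite /P.
  rewrite (_ : \1_ _ = fun t => \1_`]- N, N] t + (-1) * \1_(B `&` `]- N, N]) t).
    by apply: vanishing_oscillationD;
      [exact: vanishing_oscillation_itv|exact: vanishing_oscillationZ].
  apply/funext => t; rewrite !indicE !in_setI in_setC.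
  by case: (_ \in B); case: (_ \in _) => /=; rewrite ?mulr1 ?mulr0 ?subrr ?addr0.
- move=> F mF tF PF; rewrite /P.
  (* disjointness makes the indicator of a partial union a finite sum *)
  pose U n := \1_(\big[setU/set0]_(i < n) F i `&` `]- N, N]) : R -> R.
  apply: (@vanishing_oscillation_dominated _ U _ (\1_`]- N, N])).
  + move=> n; rewrite /U.
    rewrite (_ : \1_ _ = fun t => \sum_(i < n) \1_(F i `&` `]- N, N]) t).
      by apply: vanishing_oscillation_sum => i; exact: PF.
    apply/funext => t; elim: n => [|n ih].
      by rewrite !big_ord0 indicE set0I in_set0.
    rewrite !big_ord_recr/= -ih !indicE !in_setI in_setU.
    case: (boolP (t \in F n)) => Fnt; last by rewrite orbF addr0.
    rewrite (_ : (t \in _) = false) ?add0r//; apply/negP; rewrite inE.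
    rewrite -bigcup_mkord => -[i /= iltn Fit].
    move/trivIsetP : tF => /(_ i n Logic.I Logic.I).
    rewrite (ltn_eqF iltn) => /(_ isT); rewrite -subset0 => /(_ t); apply.
    by split => //; rewrite inE in Fnt.
  + by have [] := @vanishing_oscillation_itv R (- N) N.
  + move=> n t; rewrite /U !indicE in_setI.
    by case: (_ \in _); case: (_ \in _); rewrite ?normr1 ?normr0.
  + move=> t; rewrite /U; under eq_fun do rewrite indicI; rewrite indicI.
    apply: cvgM; last exact: cvg_cst.
    exact: cvg_indic_bigcup.
Qed.

Lemma vanishing_oscillation_borel (A : set R) :
  measurable (A : set (measurableTypeR R)) ->
  mu.-integrable setT (EFin \o (\1_A : R -> R)) ->
  vanishing_oscillation \1_A.
Proof.
move=> mA iA.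
apply: (@vanishing_oscillation_dominated _
  (fun n => \1_(A `&` `](- n%:R), n%:R])) _ \1_A) => //.
- by move=> n; exact: vanishing_oscillation_borel_bounded.
- move=> n t; rewrite !indicE in_setI.
  by case: (_ \in _); case: (_ \in _); rewrite ?normr1 ?normr0.
- move=> t; under eq_fun do rewrite indicI.
  suff : \1_A t * \1_`](- n%:R), n%:R] t @[n --> \oo] --> (\1_A t * 1 : R).
    by rewrite mulr1.
  apply: cvgM; first exact: cvg_cst.
  apply: (@cvg_near_cst _ _ _ _ _ _).
  near=> n; rewrite indicE mem_set//= in_itv/=.
  have tn : `|t| < n%:R by near: n; exact: nbhs_infty_gtr.
  by move: tn; rewrite ltr_norml => /andP[-> /ltW ->].
Unshelve. all: by end_near. Qed.

(** A Lebesgue set contains a Borel set of the same measure, whose indicator is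
    at L1 distance zero from that of the given set. *)
Lemma vanishing_oscillation_indic (A : set R) :
  measurable (A : set (LebT R)) ->
  mu.-integrable setT (EFin \o (\1_A : R -> R)) ->
  vanishing_oscillation \1_A.
Proof.
move=> mA iA.
have : (completed_algebra_gen (@lebesgue_measure R)).-sigma.-measurable A.
  by rewrite completed_caratheodory_measurable.
rewrite g_sigma_completed_algebra_genE => -[B mB [N [C [mC C0 NC]] BNA]].
have mB' := Leb_measurable mB; have mC' := Leb_measurable mC.
have BA : B `<=` A by rewrite -BNA; exact: subsetUl.
apply: vanishing_oscillation_approx => // e e0; exists \1_B.
  apply: vanishing_oscillation_borel => //.
  apply: (le_integrable measurableT _ _ iA).
    by apply/measurable_EFinP; exact: measurable_indic.
  move=> t _ /=; rewrite lee_fin !indicE.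
  case: (boolP (t \in B)) => [|_]; last by rewrite normr0.
  by rewrite inE => /BA tA; rewrite mem_set.
apply: (@le_trans _ _ 0); last exact: ltW.
rewrite (_ : Rintegral _ _ _ = 0)//.
rewrite /Rintegral (_ : (\int[mu]_t _)%E = mu (A `\` B)).
  rewrite (_ : mu (A `\` B) = 0%E)//; apply/eqP.
  rewrite eq_le measure_ge0 andbT -C0.
  apply: le_measure; rewrite ?inE//; first exact: measurableD.
  by move=> t [+ nB]; rewrite -BNA => -[|/NC].
have := @integral_indic _ _ _ mu setT measurableT (A `\` B) (measurableD mA mB').
rewrite setIT => E; apply: etrans E; apply: eq_integral => t _; rewrite !indicE in_setD.
case: (boolP (t \in B)) => [|_].
  by rewrite inE => /BA tA; rewrite mem_set//= subrr normr0.
by rewrite subr0 andbT; case: (_ \in _); rewrite ?normr1 ?normr0.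
Qed.

Import HBSimple.

(** Integrable simple functions are L1-dense, and the level set of an
    integrable simple function at a nonzero value has an integrable indicator. *)
Theorem riemann_lebesgue k : mu.-integrable setT (EFin \o k) ->
  vanishing_oscillation k.
Proof.
move=> ki; apply: vanishing_oscillation_approx => // e e0.
have [g [gi _ /fine_cvgP[_ /cvgrPdist_le/(_ _ e0)[N _ /(_ N (leqnn N))]]]] :=
  approximation_sfun_integrable measurableT ki.
rewrite sub0r normrN => hN; exists (g N); last first.
  exact: le_trans (ler_norm _) hN.
rewrite (_ : (g N : R -> R) = fun t => \sum_(y <- finmap.enum_fset (fset_set (range (g N))))
    (y * \1_(g N @^-1` [set y]) t)); last first.
  by apply/funext => t; rewrite [LHS]fimfunE fsbig_finite.
apply: vanishing_oscillation_sum => y.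
have [->|y0] := eqVneq y 0.
  by under eq_fun do rewrite mul0r; exact: vanishing_oscillation0.
apply: vanishing_oscillationZ.
have mgy : measurable (g N @^-1` [set y] : set (LebT R)).
  by rewrite -[X in measurable X]setTI; exact: measurable_funP.
apply: vanishing_oscillation_indic => //.
apply: (le_integrable measurableT _ _ (integrableZl measurableT y^-1 (gi N))).
  by apply/measurable_EFinP; exact: measurable_indic.
move=> t _ /=; rewrite lee_fin indicE.
case: (boolP (t \in _)) => [|_]; last by rewrite normr0.
by rewrite inE/= => ->; rewrite mulVf.
Qed.

End riemann_lebesgue_L1.

(** * The sine integral *)

Section dirichlet_integral.
Context {R : realType}.
Local Notation mu := (@Leb R).
Implicit Types (c s t y N T : R).

Lemma normr_sin_le (u : R) : `|sin u| <= `|u|.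
Proof.
wlog u0 : u / 0 <= u.
  move=> wlg; have [|/ltW u0] := leP 0 u; first exact: wlg.
  by rewrite -normrN -sinN -[leRHS]normrN; apply: wlg; rewrite oppr_ge0.
have := Rintegral_Leb_FTC2 u0 (@continuous_cos R) (@is_derive_sin R).
rewrite sin0 subr0 => <-.
have -> : `|u| = \int[mu]_(t in `[0, u]) 1.
  by rewrite Rintegral_Leb_cst// mul1r subr0 ger0_norm.
apply: Rintegral_le_bound.
- exact: Leb_measurable_itv.
- by apply: Leb_integrable_continuous_itv; exact: continuous_cos.
- by apply: Leb_integrable_continuous_itv => t; exact: cvg_cst.
- by move=> t _; exact: normr_cos_le1.
Qed.

Lemma continuous_expR_scale s : continuous (fun y : R => expR (- (s * y))).
Proof.
move=> y; apply: (@continuous_comp _ _ _ (fun u => - (s * u)) expR);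
  last exact: continuous_expR.
by apply: cvgN; apply: cvgMr; exact: cvg_id.
Qed.

Lemma Rintegral_expR s N : 0 <= N -> s != 0 ->
  \int[mu]_(y in `[0, N]) expR (- (s * y)) = (1 - expR (- (s * N))) / s.
Proof.
move=> N0 s0.
have dF (y : R) : is_derive y 1 (fun u => - (expR (- (s * u)) / s)) (expR (- (s * y))).
  have h1 : is_derive y 1 (fun u : R => - (s * u)) (- s).
    by apply: is_derive_eq; rewrite /GRing.scale/=; ring.
  have h2 := @is_derive1_comp R expR (fun u : R => - (s * u)) y _ _ (is_derive_expR _) h1.
  have h3 := is_deriveN (is_deriveM h2 (is_derive_cst s^-1 y 1)).
  apply: (is_derive_eq h3).
  by rewrite scaler0 add0r /GRing.scale/=; field.
rewrite (Rintegral_Leb_FTC2 N0 (@continuous_expR_scale s) dF).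
by rewrite mulr0 oppr0 expR0; field.
Qed.

Lemma Rintegral_sin_expR c y T : 0 <= T -> 0 < c ->
  \int[mu]_(s in `[0, T]) (sin (c * s) * expR (- (s * y))) =
  (c - expR (- (y * T)) * (y * sin (c * T) + c * cos (c * T))) / (c ^+ 2 + y ^+ 2).
Proof.
move=> T0 c0.
have cy0 : c ^+ 2 + y ^+ 2 != 0.
  by rewrite gt_eqF// ltr_pwDl ?exprn_gt0// sqr_ge0.
have cf : continuous (fun s => sin (c * s) * expR (- (s * y))).
  have c1 : continuous (fun s => sin (c * s)).
    move=> s.
    apply: (@continuous_comp _ _ _ (fun u => c * u) sin); last exact: continuous_sin.
    by apply: cvgMr; exact: cvg_id.
  have c2 : continuous (fun s => expR (- (s * y))).
    by under [X in continuous X]eq_fun do rewrite mulrC; exact: continuous_expR_scale.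
  by move=> s; apply: cvgM; [exact: c1|exact: c2].
have dF (s : R) : is_derive s 1 (fun u => - (expR (- (y * u)) *
   (y * sin (c * u) + c * cos (c * u)) / (c ^+ 2 + y ^+ 2)))
   (sin (c * s) * expR (- (s * y))).
  have h1 : is_derive s 1 (fun u : R => - (y * u)) (- y).
    by apply: is_derive_eq; rewrite /GRing.scale/=; ring.
  have h2 := @is_derive1_comp R expR (fun u : R => - (y * u)) s _ _ (is_derive_expR _) h1.
  have k1 : is_derive s 1 (fun u : R => c * u) c.
    by apply: is_derive_eq; rewrite /GRing.scale/=; ring.
  have k2 := @is_derive1_comp R sin (fun u : R => c * u) s _ _ (is_derive_sin _) k1.
  have k3 := @is_derive1_comp R cos (fun u : R => c * u) s _ _ (is_derive_cos _) k1.
  have k4 := is_deriveD (is_deriveM (is_derive_cst y s 1) k2)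
    (is_deriveM (is_derive_cst c s 1) k3).
  have h3 := is_deriveN (is_deriveM (is_deriveM h2 k4)
    (is_derive_cst (c ^+ 2 + y ^+ 2)^-1 s 1)).
  apply: (is_derive_eq h3).
  rewrite /GRing.scale/= /GRing.scale/= (mulrC s y).
  rewrite (_ : (cst y * _ + cst c * _) s = y * sin (c * s) + c * cos (c * s))//.
  by rewrite mulr0; field.
rewrite (Rintegral_Leb_FTC2 T0 cf dF).
by rewrite !mulr0 oppr0 expR0 sin0 cos0; field.
Qed.

Lemma Rintegral_atan c N : 0 <= N -> 0 < c ->
  \int[mu]_(y in `[0, N]) (c / (c ^+ 2 + y ^+ 2)) = atan (N / c).
Proof.
move=> N0 c0.
have cy0 y : c ^+ 2 + y ^+ 2 != 0.
  by rewrite gt_eqF// ltr_pwDl ?exprn_gt0// sqr_ge0.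
have cf : continuous (fun y => c / (c ^+ 2 + y ^+ 2)).
  move=> y; apply: cvgM; first exact: cvg_cst.
  apply: cvgV => //; apply: cvgD; first exact: cvg_cst.
  exact: exprn_continuous.
have dF (y : R) : is_derive y 1 (fun u => atan (u / c)) (c / (c ^+ 2 + y ^+ 2)).
  have h1 : is_derive y 1 (fun u : R => u / c) c^-1.
    by apply: is_derive_eq; rewrite /GRing.scale/=; ring.
  have h2 := @is_derive1_comp R atan (fun u : R => u / c) y _ _ (is_derive1_atan _) h1.
  apply: (is_derive_eq h2).
  have -> : 1 + (y / c) ^+ 2 = (c ^+ 2 + y ^+ 2) / c ^+ 2 by field; rewrite gt_eqF.
  by field; rewrite cy0 gt_eqF.
by rewrite (Rintegral_Leb_FTC2 N0 cf dF) mul0r atan0 subr0.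
Qed.

Definition sine_integral c T := \int[mu]_(s in `[0, T]) (sin (c * s) / s).

Lemma sine_integral_integrable c T :
  mu.-integrable `[0, T] (EFin \o (fun s => sin (c * s) / s)).
Proof.
apply: (@Leb_integrable_bounded_itv _ _ _ `|c|).
  apply: measurable_fun_Leb; apply: measurable_funM; last exact: measurable_inv_real.
  apply: continuous_measurable_fun => s.
  apply: (@continuous_comp _ _ _ (fun u => c * u) sin); last exact: continuous_sin.
  by apply: cvgMr; exact: cvg_id.
move=> s _; have [->|s0] := eqVneq s 0; first by rewrite invr0 mulr0 normr0.
rewrite normrM normfV ler_pdivrMr ?normr_gt0// -normrM.
exact: normr_sin_le.
Qed.

Lemma sine_integralN c T : sine_integral (- c) T = - sine_integral c T.
Proof.
rewrite /sine_integral -[RHS]mulN1r -RintegralZl.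
- by apply: eq_Rintegral => s _; rewrite mulNr sinN mulN1r mulNr.
- exact: Leb_measurable_itv.
- exact: sine_integral_integrable.
Qed.

(** Integrate [sin(cs) e^(-sy)] over [0 <= s <= T] and [0 <= y <= N] in both
    orders.  Integrating in [y] first gives the sine integral up to an error of
    at most [c/N]; integrating in [s] first gives the integral of
    [c/(c^2 + y^2)], which is [atan(N/c)], up to an error of at most [2/(cT)].
    The cutoff [N = c^2 T] makes the first error [1/(cT)] and the main term
    [atan(cT)]. *)
Lemma sine_integral_atan c T : 0 < c -> 0 < T ->
  `|sine_integral c T - atan (c * T)| <= 3 / (c * T).
Proof.
move=> c0 T0.
pose N := c ^+ 2 * T.
have N0 : 0 < N by rewrite mulr_gt0// exprn_gt0.
have cy0 y : 0 < c ^+ 2 + y ^+ 2 by rewrite ltr_pwDl ?exprn_gt0// sqr_ge0.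
have cy0' y : c ^+ 2 + y ^+ 2 != 0 by rewrite gt_eqF.
have csin : continuous (fun s => sin (c * s)).
  move=> s.
  apply: (@continuous_comp _ _ _ (fun u => c * u) sin); last exact: continuous_sin.
  by apply: cvgMr; exact: cvg_id.
have [] := @Rintegral_fubini_bounded _ _ (LebT R) (LebT R) R mu mu `[0, T] `[0, N]
  (fun s => sin (c * s)) (fun z => expR (- ((z.1 : R) * (z.2 : R)))) 1
  (Leb_measurable_itv _) (Leb_measurable_itv _) (Leb_itv_fin _ _)
  (Leb_integrable_continuous_itv _ _ csin).
- apply: measurableT_comp; first exact: measurable_expR.
  apply: measurableT_comp; first exact: oppr_measurable.
  by apply: measurable_funM; apply: (measurableT_comp Leb_id_measurable);
    [exact: measurable_fst|exact: measurable_snd].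
- move=> s y /=; rewrite !in_itv/= => /andP[s0 _] /andP[y0 _].
  by rewrite ger0_norm ?expR_ge0// -expR0 ler_expR oppr_le0 mulr_ge0.
move=> /= fub _.
pose E1 := \int[mu]_(s in `[0, T]) (sin (c * s) / s * expR (- (N * s))).
pose E2 := \int[mu]_(y in `[0, N]) (expR (- (T * y)) *
  ((y * sin (c * T) + c * cos (c * T)) / (c ^+ 2 + y ^+ 2))).
have cexp s : continuous (fun y : R => expR (- (s * y))) by exact: continuous_expR_scale.
have expn1 s y : 0 <= s -> 0 <= y -> `|expR (- (s * y))| <= 1.
  by move=> s0 y0; rewrite ger0_norm ?expR_ge0// -expR0 ler_expR oppr_le0 mulr_ge0.
have i1 : mu.-integrable `[0, T] (EFin \o (fun s => sin (c * s) / s * expR (- (N * s)))).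
  apply: (@integrable_mulr_bounded _ _ _ mu `[0, T] _ _ 1 (Leb_measurable_itv _)
    (sine_integral_integrable c T)).
    by apply: Leb_continuous_measurable; exact: cexp.
  by move=> s /=; rewrite in_itv/= => /andP[s0 _]; exact: expn1 (ltW N0) s0.
have ci : continuous (fun y : R => (c ^+ 2 + y ^+ 2)^-1).
  move=> y; apply: cvgV => //; apply: cvgD; first exact: cvg_cst.
  exact: exprn_continuous.
have ca : continuous (fun y : R => c / (c ^+ 2 + y ^+ 2)).
  by move=> y; apply: cvgM; [exact: cvg_cst|exact: ci].
have cr : continuous (fun y : R => expR (- (T * y)) *
  ((y * sin (c * T) + c * cos (c * T)) / (c ^+ 2 + y ^+ 2))).
  move=> y; apply: cvgM; first exact: cexp.
  apply: cvgM; last exact: ci.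
  by apply: cvgD; [apply: cvgMl; exact: cvg_id|exact: cvg_cst].
have L : sine_integral c T - E1 = atan (c * T) - E2.
  transitivity (\int[mu]_(s in `[0, T]) (sin (c * s) *
      \int[mu]_(y in `[0, N]) expR (- (s * y)))).
    rewrite /sine_integral /E1 -RintegralB//; last 2 first.
    - exact: Leb_measurable_itv.
    - exact: sine_integral_integrable.
    apply: eq_Rintegral => s _.
    (* at [s = 0] both sides vanish because [0^-1 = 0] and [sin 0 = 0] *)
    have [->|s0] := eqVneq s 0; first by rewrite mulr0 sin0 !mul0r subrr.
    by rewrite Rintegral_expR ?ltW// (mulrC N); field.
  rewrite fub -[c * T](_ : N / c = _); last by rewrite /N; field; rewrite gt_eqF.
  rewrite -Rintegral_atan ?ltW// /E2 -RintegralB.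
  - apply: eq_Rintegral => y _; rewrite Rintegral_sin_expR ?ltW// (mulrC y T).
    by field.
  - exact: Leb_measurable_itv.
  - exact: Leb_integrable_continuous_itv.
  - exact: Leb_integrable_continuous_itv.
have bE1 : `|E1| <= 1 / (c * T).
  apply: (@le_trans _ _ (\int[mu]_(s in `[0, T]) (c * expR (- (N * s))))).
    apply: Rintegral_le_bound => //.
    - exact: Leb_measurable_itv.
    - apply: Leb_integrable_continuous_itv => s; apply: cvgM; first exact: cvg_cst.
      exact: cexp.
    - move=> s _; rewrite normrM [X in _ * X]ger0_norm ?expR_ge0//.
      rewrite ler_wpM2r ?expR_ge0//.
      have [->|s0] := eqVneq s 0; first by rewrite invr0 mulr0 normr0 ltW.
      rewrite normrM normfV ler_pdivrMr ?normr_gt0//.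
      by apply: le_trans (normr_sin_le _) _; rewrite normrM (gtr0_norm c0).
  rewrite RintegralZl; last 2 first.
  - exact: Leb_measurable_itv.
  - by apply: Leb_integrable_continuous_itv; exact: cexp.
  rewrite Rintegral_expR ?(ltW T0) ?(ltW N0) ?gt_eqF//.
  rewrite [leRHS](_ : _ = c * (1 / N)); last by rewrite /N; field; rewrite !gt_eqF.
  apply: ler_wpM2l; first exact: ltW.
  apply: ler_wpM2r; first by rewrite invr_ge0 ltW.
  by rewrite gerBl expR_ge0.
have bE2 : `|E2| <= 2 / (c * T).
  apply: (@le_trans _ _ (\int[mu]_(y in `[0, N]) (2 / c * expR (- (T * y))))).
    apply: Rintegral_le_bound => //.
    - exact: Leb_measurable_itv.
    - exact: Leb_integrable_continuous_itv.
    - apply: Leb_integrable_continuous_itv => s; apply: cvgM; first exact: cvg_cst.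
      exact: cexp.
    - move=> y /=; rewrite in_itv/= => /andP[y0 _].
      rewrite normrM [X in X * _]ger0_norm ?expR_ge0// mulrC.
      rewrite ler_wpM2r ?expR_ge0// normrM normfV (gtr0_norm (cy0 y)).
      rewrite ler_pdivrMr// mulrAC ler_pdivlMr//.
      apply: (@le_trans _ _ ((y + c) * c)); last by nra.
      apply: ler_wpM2r; first exact: ltW.
      apply: le_trans (ler_normD _ _) _.
      rewrite !normrM (ger0_norm y0) (gtr0_norm c0); apply: lerD.
        by rewrite ler_piMr// sin_max.
      by rewrite ler_piMr ?(ltW c0)// normr_cos_le1.
  rewrite RintegralZl; last 2 first.
  - exact: Leb_measurable_itv.
  - by apply: Leb_integrable_continuous_itv; exact: cexp.
  rewrite Rintegral_expR ?(ltW T0) ?(ltW N0) ?gt_eqF//.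
  rewrite [leRHS](_ : _ = 2 / c * (1 / T)); last by field; rewrite !gt_eqF.
  apply: ler_wpM2l; first by rewrite divr_ge0 ?(ltW c0).
  apply: ler_wpM2r; first by rewrite invr_ge0 ltW.
  by rewrite gerBl expR_ge0.
have -> : sine_integral c T - atan (c * T) = E1 - E2.
  by move: L => /eqP; rewrite subr_eq => /eqP ->; ring.
apply: le_trans (ler_normB _ _) _.
apply: le_trans (lerD bE1 bE2) _.
by rewrite -mulrDl (_ : 1 + 2 = 3 :> R)//; ring.
Qed.

End dirichlet_integral.

Section sine_integral_limit.
Context {R : realType}.
Local Notation mu := (@Leb R).
Implicit Types (c s t y T : R).

Lemma sine_integral0 T : sine_integral 0 T = 0.
Proof.
rewrite /sine_integral; under eq_Rintegral do rewrite mul0r sin0 mul0r.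
by rewrite Rintegral_cst ?mul0r//; exact: Leb_measurable_itv.
Qed.

(** By oddness [c > 0].  For [cT <= 1] the integrand is at most [c] in absolute
    value, hence the integral is at most [1]; for [cT > 1] the integral is within [3] of an arctangent, which lies in [0, 2]. *)
Lemma sine_integral_bound c T : `|sine_integral c T| <= 5.
Proof.
wlog c0 : c / 0 < c.
  move=> wlg; have [c0|c0|->] := ltgtP c 0; last 1 first.
  - by rewrite sine_integral0 normr0.
  - by rewrite -normrN -sine_integralN; apply: wlg; rewrite oppr_gt0.
  - exact: wlg.
have [T0|T0] := leP T 0.
  have -> : sine_integral c T = 0.
    move: T0; rewrite le_eqVlt => /predU1P[->|T0].
      rewrite /sine_integral (@eq_Rintegral _ _ _ _ _ (fun=> 0)).
        by rewrite Rintegral_Leb_cst// mul0r.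
      move=> s; rewrite inE/= in_itv/= => /le_anti <-.
      by rewrite mulr0 sin0 mul0r.
    by rewrite /sine_integral set_itv_ge ?bnd_simp -?ltNge// Rintegral_set0.
  by rewrite normr0.
have [cT|cT] := leP (c * T) 1.
  apply: (@le_trans _ _ (\int[mu]_(s in `[0, T]) c)).
    apply: Rintegral_le_bound.
    - exact: Leb_measurable_itv.
    - exact: sine_integral_integrable.
    - by apply: Leb_integrable_continuous_itv => s; exact: cvg_cst.
    - move=> s _; have [->|s0] := eqVneq s 0; first by rewrite invr0 mulr0 normr0 ltW.
      rewrite normrM normfV ler_pdivrMr ?normr_gt0//.
      by apply: le_trans (normr_sin_le _) _; rewrite normrM (gtr0_norm c0).
  rewrite Rintegral_Leb_cst ?(ltW T0)// subr0; apply: (le_trans cT).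
  by rewrite ler1n.
have := sine_integral_atan c0 T0.
have a0 : 0 <= atan (c * T) by rewrite -atan0 ltW// lt_atan// mulr_gt0.
have a2 : atan (c * T) <= 2.
  by apply: (le_trans (ltW (atan_ltpi2 _))); have /andP[_ /ltW] := @pihalf_02 R.
have c3 : 3 / (c * T) <= 3.
  by rewrite ler_pdivrMr ?mulr_gt0// ler_peMr// ltW.
rewrite ler_distl => /andP[h1 h2].
rewrite ler_norml; lra.
Qed.

Lemma sine_integral_cvg c : 0 < c -> sine_integral c T @[T --> +oo] --> (pi / 2 : R).
Proof.
move=> c0.
have cTy : c * T @[T --> +oo] --> +oo by exact: (gt0_cvgMry c0 cvg_id).
have at_cvg : atan (c * T) @[T --> +oo] --> (pi / 2 : R).
  by apply: (@cvg_comp _ _ _ (fun T => c * T) atan _ _ _ cTy); exact: cvgy_atan.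
apply/cvgrPdist_le => e e0.
have e2 : 0 < e / 2 by rewrite divr_gt0.
near=> T.
have T0 : 0 < T by near: T; exact: nbhs_pinfty_gt.
have := sine_integral_atan c0 T0.
have h3 : 3 / (c * T) <= e / 2.
  have : 3 / (e / 2) / c <= T by near: T; apply: nbhs_pinfty_ge; exact: num_real.
  rewrite ler_pdivrMr// ler_pdivrMr// => h; rewrite ler_pdivrMr ?mulr_gt0//.
  by apply: (le_trans h); rewrite mulrC (mulrC T).
have h2 : `|pi / 2 - atan (c * T)| <= e / 2.
  by near: T; move/cvgrPdist_le : at_cvg; exact.
move=> h1; rewrite (splitr e).
rewrite (_ : pi / 2 - _ = (pi / 2 - atan (c * T)) -
  (sine_integral c T - atan (c * T))); last by ring.
apply: le_trans (ler_normB _ _) _; apply: lerD => //.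
exact: le_trans h3.
Unshelve. all: by end_near. Qed.

Lemma sine_integral_cvgN c : c < 0 -> sine_integral c T @[T --> +oo] --> (- (pi / 2) : R).
Proof.
move=> c0; rewrite -(opprK c).
under eq_fun do rewrite sine_integralN.
by apply: cvgN; apply: sine_integral_cvg; rewrite oppr_gt0.
Qed.

End sine_integral_limit.

(** * The Dirichlet kernel *)

Section dirichlet_kernel.
Context {R : realType}.
Local Notation mu := (@Leb R).
Implicit Types (c s t y T x v : R).

(** For [T >= 0] this is [sin(Tu)/u] away from [u = 0].  The integral form has
    the right value [T] at [u = 0], and lets Fubini apply without a case split. *)
Definition dirichlet_kernel T u := \int[mu]_(s in `[0, T]) cos (u * s).

Lemma Rintegral_cos_affine s p (a b : R) : a <= b -> s != 0 ->
  \int[mu]_(t in `[a, b]) cos (s * t + p) = (sin (s * b + p) - sin (s * a + p)) / s.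
Proof.
move=> ab s0.
rewrite (Rintegral_Leb_FTC2 ab (@continuous_cos_affine _ s p)
  (is_derive_sin_affine p s0)).
by rewrite mulrBl.
Qed.

Lemma continuous_cos_scale s : continuous (fun t => cos (s * t)).
Proof.
move=> t; apply: (@continuous_comp _ _ _ (fun u => s * u) cos); last exact: continuous_cos.
by apply: cvgMr; exact: cvg_id.
Qed.

Lemma measurable_cos_prod x q : measurable_fun setT
  (fun z : LebT R * LebT R => cos ((x - (z.1 : R)) * (z.2 : R) + q)).
Proof.
apply: (measurableT_comp (continuous_measurable_fun (@continuous_cos R))).
apply: measurable_funD; last exact: measurable_cst.
apply: measurable_funM.
  apply: measurable_funB; first exact: measurable_cst.
  exact: (measurableT_comp Leb_id_measurable measurable_fst).
exact: (measurableT_comp Leb_id_measurable measurable_snd).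
Qed.

Lemma normr_dirichlet_kernel T u : `|dirichlet_kernel T u| <= `|T|.
Proof.
rewrite /dirichlet_kernel; have [T0|T0] := leP 0 T; last first.
  by rewrite set_itv_ge ?bnd_simp -?ltNge// Rintegral_set0 normr0.
apply: (@le_trans _ _ (\int[mu]_(s in `[0, T]) 1)).
  apply: Rintegral_le_bound.
  - exact: Leb_measurable_itv.
  - by apply: Leb_integrable_continuous_itv; exact: continuous_cos_scale.
  - by apply: Leb_integrable_continuous_itv => s; exact: cvg_cst.
  - by move=> s _; exact: normr_cos_le1.
by rewrite Rintegral_Leb_cst// mul1r subr0 ger0_norm.
Qed.

Lemma dirichlet_kernel_integrable (a b x T : R) :
  mu.-integrable `[a, b] (EFin \o (fun t => dirichlet_kernel T (x - t))).
Proof.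
apply: (@Leb_integrable_bounded_itv _ _ _ `|T|).
  have [] := @Rintegral_fubini_bounded _ _ (LebT R) (LebT R) R mu mu `[0, T] `[a, b]
    (cst 1) (fun z => cos ((x - (z.2 : R)) * (z.1 : R) + 0)) 1
    (Leb_measurable_itv _) (Leb_measurable_itv _) (Leb_itv_fin _ _).
  - by apply: Leb_integrable_continuous_itv => t; exact: cvg_cst.
  - have := measurableT_comp (measurable_cos_prod x 0) (@measurable_swap _ _ (LebT R) (LebT R)).
    exact.
  - by move=> s y _ _; exact: normr_cos_le1.
  move=> _; apply: eq_measurable_fun => t _.
  by apply: eq_Rintegral => s _; rewrite mul1r addr0.
by move=> t _; exact: normr_dirichlet_kernel.
Qed.

(** Integrating [cos((x-t)s)] in [t] first produces the two sine integrals
    directly, in place of a change of variables in [sin(Tu)/u]. *)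
Lemma Rintegral_dirichlet_kernel (v b x T : R) : v <= b ->
  \int[mu]_(t in `[v, b]) dirichlet_kernel T (x - t) =
  sine_integral (b - x) T + sine_integral (x - v) T.
Proof.
move=> vb.
have [] := @Rintegral_fubini_bounded _ _ (LebT R) (LebT R) R mu mu `[v, b] `[0, T]
  (cst 1) (fun z => cos ((x - (z.1 : R)) * (z.2 : R) + 0)) 1
  (Leb_measurable_itv _) (Leb_measurable_itv _) (Leb_itv_fin _ _).
- by apply: Leb_integrable_continuous_itv => t; exact: cvg_cst.
- exact: measurable_cos_prod.
- by move=> s y _ _; exact: normr_cos_le1.
move=> fub mfub.
transitivity (\int[mu]_(s in `[0, T]) \int[mu]_(t in `[v, b]) (cst 1 t * cos ((x - t) * s + 0))).
  rewrite -fub; apply: eq_Rintegral => t _; rewrite mul1r.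
  by apply: eq_Rintegral => s _; rewrite addr0.
rewrite /sine_integral -RintegralD; last 3 first.
- exact: Leb_measurable_itv.
- exact: sine_integral_integrable.
- exact: sine_integral_integrable.
(* at [s = 0] the inner integral is [b - v], while the quotients are zero *)
apply: (@Rintegral_eq_off_point _ _ 0).
- exact: Leb_measurable_itv.
- exact: mfub.
- have /(measurable_int mu)/measurable_EFinP := integrableD (Leb_measurable_itv _)
    (@sine_integral_integrable R (b - x) T) (@sine_integral_integrable R (x - v) T).
  exact.
move=> s _ s0.
transitivity (\int[mu]_(t in `[v, b]) cos (- s * t + s * x)).
  by apply: eq_Rintegral => t _; rewrite mul1r addr0; congr cos; ring.
rewrite Rintegral_cos_affine// ?oppr_eq0//.
have -> : - s * b + s * x = - ((b - x) * s) by ring.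
have -> : - s * v + s * x = (x - v) * s by ring.
by rewrite sinN; field.
Qed.

End dirichlet_kernel.

(** * The Dirichlet-Jordan theorem *)

Section dirichlet_jordan.
Context {R : realType}.
Local Notation mu := (@Leb R).
Implicit Types (c s t y T x v : R).

Lemma Rintegral_layer (c d l : R) : c <= l <= d ->
  \int[mu]_(y in `[c, d]) \1_`]-oo, l[ y = l - c.
Proof.
move=> /andP[cl ld].
have := @integral_indic _ _ _ mu `[c, d] (Leb_measurable_itv _)
  `]-oo, l[ (Leb_measurable_itv _).
have -> : `]-oo, l[ `&` `[c, d] = `[c, l[%classic.
  apply/seteqP; split => y /=; rewrite !in_itv/=.
    by move=> [-> /andP[-> _]].
  by move=> /andP[-> yl]; rewrite yl; split => //=; exact: le_trans (ltW yl) ld.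
move=> E; rewrite /Rintegral E.
have := @lebesgue_measure_itv R `[c, l[; rewrite /= lte_fin => E'.
transitivity (fine (@lebesgue_measure R `[c, l[%classic)) => //.
rewrite E'; case: ltgtP cl => //= -> _; by rewrite subrr.
Qed.

Lemma upper_set_bound (a b : R) (P : R -> Prop) : a <= b ->
  (forall s t, P s -> s <= t -> P t) ->
  exists v, [/\ a <= v <= b, forall t, a <= t <= b -> P t -> v <= t &
    forall t, v < t <= b -> P t].
Proof.
move=> ab Pup.
pose U := [set t | a <= t <= b /\ P t].
have [[u Uu]|U0] := pselect (U !=set0); last first.
  exists b; split.
  - by rewrite ab lexx.
  - by move=> t abt Pt; exfalso; apply: U0; exists t.
  - by move=> t /andP[bt tb]; have := lt_le_trans bt tb; rewrite ltxx.
have lbU : lbound U a by move=> t [/andP[]].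
have infU : has_inf U by split; [exists u|exists a].
exists (inf U); split.
- apply/andP; split; first by apply: lb_le_inf => //; exists u.
  by apply: le_trans (ge_inf infU.2 Uu) _; case: Uu => /andP[].
- by move=> t abt Pt; apply: ge_inf => //; exact: infU.2.
- move=> t /andP[vt tb].
  have e0 : 0 < t - inf U by rewrite subr_gt0.
  have [w [_ Pw] wt] := inf_adherent e0 infU.
  by apply: (Pup w) => //; rewrite ltW// (lt_le_trans wt)// addrC subrK.
Qed.

Variables (a b x : R) (h : R -> R) (L r : R).
Hypothesis axb : a < x < b.
Hypothesis hmono : {homo h : s t / s <= t}.
Hypothesis hL : forall t, t < x -> h t <= L.
Hypothesis hL' : forall y, y < L -> exists2 t, a <= t < x & y < h t.
Hypothesis hR : forall t, x < t -> r <= h t.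
Hypothesis hR' : forall y, r < y -> exists2 t, x < t <= b & h t < y.

Let ax : a < x. Proof. by case/andP: axb. Qed.
Let xb : x < b. Proof. by case/andP: axb. Qed.
Let ab : a < b. Proof. exact: lt_trans ax xb. Qed.

Let LR : L <= r.
Proof.
rewrite leNgt; apply/negP => RL.
have [t /andP[_ tx]] := hL' (midf_lt RL).2.
have [u /andP[xu _] hu] := hR' (midf_lt RL).1.
move=> ht; have := lt_trans hu ht; rewrite ltNge => /negP; apply.
exact/hmono/ltW/(lt_trans tx xu).
Qed.

Let haL : h a <= L. Proof. exact: hL ax. Qed.
Let rhb : r <= h b. Proof. exact: hR xb. Qed.

Let slice T y := \int[mu]_(t in `[a, b])
  (dirichlet_kernel T (x - t) * \1_`]-oo, h t[ y).

Let mh : measurable_fun (setT : set (LebT R)) h.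
Proof. by apply: measurable_fun_Leb; exact: nondecreasing_measurable. Qed.

Let mk : measurable_fun setT (fun z : LebT R * LebT R => \1_`]-oo, h z.1[ (z.2 : R) : R).
Proof.
pose S := [set z : LebT R * LebT R | (z.2 : R) < h z.1].
suff mS : measurable S.
  apply: (eq_measurable_fun (\1_S : _ -> R)); last exact: measurable_indic.
  move=> z _; rewrite !indicE.
  suff -> : (z \in S) = ((z.2 : R) \in `]-oo, h z.1[%classic) by [].
  by apply/idP/idP => /set_mem hz; apply/mem_set; move: hz; rewrite /S/= in_itv.
have mf : measurable_fun setT (fun z : LebT R * LebT R => h z.1 - (z.2 : R)).
  apply: measurable_funB; first exact: (measurableT_comp mh measurable_fst).
  exact: (measurableT_comp Leb_id_measurable measurable_snd).
have := mf measurableT `]0, +oo[%classic (measurable_itv _).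
rewrite setTI; congr (measurable _).
by apply/seteqP; split => z /=; rewrite in_itv/= andbT subr_gt0.
Qed.

Let slice_fubini T :
  \int[mu]_(t in `[a, b]) (dirichlet_kernel T (x - t) * (h t - h a)) =
    \int[mu]_(y in `[h a, h b]) slice T y /\
  measurable_fun (`[h a, h b] : set (LebT R)) (slice T).
Proof.
have [] := @Rintegral_fubini_bounded _ _ (LebT R) (LebT R) R mu mu `[a, b] `[h a, h b]
  (fun t => dirichlet_kernel T (x - t))
  (fun z => \1_`]-oo, h z.1[ (z.2 : R)) 1
  (Leb_measurable_itv _) (Leb_measurable_itv _) (Leb_itv_fin _ _)
  (dirichlet_kernel_integrable _ _ _ _) mk.
  by move=> s y _ _; exact: indic_le1.
move=> E ms; split; last exact: ms.
apply: etrans E; apply: eq_Rintegral => t.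
rewrite inE/= in_itv/= => /andP[at_ tb].
by rewrite Rintegral_layer// !hmono.
Qed.

(** The superlevel set at level [y] is an interval from some [v] to [b], so the
    slice is a sum of two sine integrals in which only [T] varies. *)
Let slice_sine y : exists v, [/\ a <= v <= b,
  (forall T, slice T y = sine_integral (b - x) T + sine_integral (x - v) T),
  forall t, a <= t <= b -> y < h t -> v <= t & forall t, v < t <= b -> y < h t].
Proof.
have [|v [/andP[av vb] v1 v2]] := @upper_set_bound a b (fun t => y < h t) (ltW ab).
  by move=> s t yhs st; apply: (lt_le_trans yhs); exact: hmono.
exists v; split => //; first exact/andP.
move=> T; rewrite -Rintegral_dirichlet_kernel// /slice.
rewrite [RHS]Rintegral_indic [LHS]Rintegral_indic.
have mK : measurable_fun (setT : set (LebT R))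
    (fun t => dirichlet_kernel T (x - t) * \1_`[v, b] t).
  have /(measurable_int mu)/measurable_EFinP := integrable_restrict (Leb_measurable_itv `[v, b])
    (dirichlet_kernel_integrable v b x T).
  exact.
(* the superlevel set may or may not contain its left endpoint [v] *)
apply: (@Rintegral_eq_off_point _ setT v _ _ measurableT _ mK).
- have mh1 : measurable_fun (setT : set (LebT R)) (fun t => \1_`]-oo, h t[ y : R).
    exact: (measurableT_comp mk (pair2_measurable (y : LebT R))).
  have mI : measurable_fun (setT : set (LebT R)) (\1_`[a, b] : R -> R).
    by apply: measurable_indic; exact: Leb_measurable_itv.
  have /(measurable_int mu)/measurable_EFinP mD := integrable_restrict (Leb_measurable_itv `[a, b])
    (dirichlet_kernel_integrable a b x T).
  by under eq_fun do rewrite mulrAC; exact: measurable_funM.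
- move=> t _ tv; rewrite -mulrA; congr (_ * _); rewrite !indicE.
  have Eab : (t \in `[a, b]%classic) = (a <= t <= b).
    by apply/idP/idP => [/set_mem|h0]; [|apply/mem_set]; rewrite /= in_itv/= ?h0.
  have Evb : (t \in `[v, b]%classic) = (v <= t <= b).
    by apply/idP/idP => [/set_mem|h0]; [|apply/mem_set]; rewrite /= in_itv/= ?h0.
  have Ey : (y \in `]-oo, h t[%classic) = (y < h t).
    by apply/idP/idP => [/set_mem|h0]; [|apply/mem_set]; rewrite /= in_itv/= ?h0.
  rewrite Eab Evb Ey; have [/andP[vt tb]|tvb] := boolP (v <= t <= b).
    rewrite v2 ?tb ?andbT ?(le_trans av vt) ?mulr1//.
    by rewrite lt_neqAle eq_sym tv.
  have [abt|] := boolP (a <= t <= b); last by rewrite mulr0.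
  rewrite mulr1; have [yh|//] := boolP (y < h t).
  by move: tvb; rewrite v1//; case/andP: abt => _ ->.
Qed.

Let slice_bound T y : `|slice T y| <= 10.
Proof.
have [v [_ -> _ _]] := slice_sine y.
apply: le_trans (ler_normD _ _) _; rewrite (_ : 10 = 5 + 5); last by ring.
by apply: lerD; exact: sine_integral_bound.
Qed.

(** The sign of [x - v] decides the limit: [v < x] when [y < L], [v = x] when
    [L < y < r], and [v > x] when [r < y].  At [y = L] and [y = r] the position of
    [v] is not determined by [y], but two levels do not affect an integral. *)
Let slice_cvg y : y != L -> y != r ->
  slice T y @[T --> +oo] --> pi / 2 * (\1_`]-oo, L[ y + \1_`]-oo, r[ y).
Proof.
move=> yL yR; have [v [/andP[av vb] vE v1 v2]] := slice_sine y.
under eq_fun do rewrite vE.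
have sb : sine_integral (b - x) T @[T --> +oo] --> (pi / 2 : R).
  by apply: sine_integral_cvg; rewrite subr_gt0.
rewrite !indicE.
have [ltyL|ltLy] := leP L y; last first.
  have ltyR := lt_le_trans ltLy LR.
  rewrite !mem_set/= ?in_itv//= mulrDr mulr1; apply: cvgD => //.
  apply: sine_integral_cvg; rewrite subr_gt0.
  have [t /andP[at_ tx] yht] := hL' ltLy.
  by apply: (le_lt_trans _ tx); apply: v1 => //; rewrite at_ ltW// (lt_trans tx xb).
have {yL} ltyL : L < y by rewrite lt_neqAle eq_sym yL.
rewrite memNset/= ?in_itv/=; last by apply/negP; rewrite -leNgt ltW.
rewrite add0r.
have [Ry|yR'] := leP r y; last first.
  rewrite mem_set/= ?in_itv//= mulr1.
  have -> : v = x.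
    apply/le_anti/andP; split; rewrite leNgt; apply/negP => vx.
      have [xm mv] := midf_lt vx.
      have mb : (x + v) / 2 <= b by rewrite ltW// (lt_le_trans mv).
      have ma : a <= (x + v) / 2 by rewrite ltW// (lt_trans ax).
      have := v1 _ _ (lt_le_trans yR' (hR xm)).
      by rewrite ma mb leNgt mv => /(_ isT).
    have [vm mx] := midf_lt vx.
    have := v2 ((v + x) / 2); rewrite vm ltW ?(lt_trans mx)// => /(_ isT).
    by rewrite ltNge (le_trans (hL mx))// ltW.
  rewrite subrr; under eq_fun do rewrite sine_integral0 addr0.
  exact: sb.
have {yR} ltRy : r < y by rewrite lt_neqAle eq_sym yR.
rewrite memNset/= ?in_itv/=; last by apply/negP; rewrite -leNgt ltW.
rewrite (_ : pi / 2 * _ = pi / 2 - pi / 2); last by rewrite mulr0 subrr.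
apply: cvgD => //.
apply: sine_integral_cvgN; rewrite subr_lt0.
have [t /andP[xt tb] hty] := hR' ltRy.
apply: (lt_le_trans xt); rewrite leNgt; apply/negP => vt.
by have := lt_trans hty (v2 t _); rewrite ltxx vt tb => /(_ isT).
Qed.

(** Slices are bounded by [10] for all [T] and [y], so dominated convergence
    applies along any sequence of values of [T] tending to infinity; the constant
    part [h(a)] of [h] is handled by the sine integrals themselves. *)
Lemma dirichlet_jordan_nondecreasing :
  \int[mu]_(t in `[a, b]) (h t * dirichlet_kernel T (x - t)) @[T --> +oo] -->
    pi / 2 * (L + r).
Proof.
apply/cvg_pinftyP => u uy.
pose lim_slice (y : R) : R := pi / 2 * (\1_`]-oo, L[ y + \1_`]-oo, r[ y).
have mlim : measurable_fun (setT : set (LebT R)) lim_slice.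
  apply: measurable_funM; first exact: measurable_cst.
  by apply: measurable_funD; apply: measurable_indic; exact: Leb_measurable_itv.
have [|||||] := @dominated_convergence _ _ _ mu `[h a, h b] (Leb_measurable_itv _)
   (fun n => EFin \o slice (u n)) (EFin \o lim_slice) (EFin \o cst 10).
- by move=> n; apply/measurable_EFinP; exact: (slice_fubini _).2.
- by apply/measurable_EFinP; exact: measurable_funTS.
- exists [set L; r]; split.
  + by apply: Leb_measurable; apply: measurableU; exact: measurable_set1.
  + apply: (@countable_lebesgue_measure0 R); exact/finite_set_countable/finite_set2.
  + move=> y /= hy; apply: contrapT => yLR; apply: hy => _.
    have yL : y != L by apply/eqP => yL; apply: yLR; left.
    have yR : y != r by apply/eqP => yR; apply: yLR; right.
    apply: cvg_EFin; first exact: nearW.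
    have /cvg_pinftyP := slice_cvg yL yR; exact.
- by apply: Leb_integrable_continuous_itv => y; exact: cvg_cst.
- by apply: aeW => y n _; rewrite /= lee_fin; exact: slice_bound.
move=> ilim _ cv.
have : \int[mu]_(y in `[h a, h b]) slice (u n) y @[n --> \oo] -->
    \int[mu]_(y in `[h a, h b]) lim_slice y.
  apply: fine_cvg; rewrite fineK; first exact: cv.
  by apply: integrable_fin_num ilim; exact: Leb_measurable_itv.
have -> : \int[mu]_(y in `[h a, h b]) lim_slice y = pi / 2 * ((L - h a) + (r - h a)).
  have ii l : mu.-integrable `[h a, h b] (EFin \o (\1_`]-oo, l[ : R -> R)).
    apply: (@Leb_integrable_bounded_itv _ _ _ 1).
      by apply: measurable_indic; exact: Leb_measurable_itv.
    by move=> t _; exact: indic_le1.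
  rewrite /lim_slice RintegralZl//; last 2 first.
  - exact: Leb_measurable_itv.
  - exact: (integrableD (Leb_measurable_itv _) (ii L) (ii r)).
  rewrite RintegralD//; last exact: Leb_measurable_itv.
  by rewrite !Rintegral_layer// ?haL ?rhb ?(le_trans haL)// (le_trans LR).
move=> cslice.
have c1 : sine_integral (b - x) (u n) @[n --> \oo] --> (pi / 2 : R).
  have /cvg_pinftyP : sine_integral (b - x) T @[T --> +oo] --> (pi / 2 : R).
    by apply: sine_integral_cvg; rewrite subr_gt0.
  exact.
have c2 : sine_integral (x - a) (u n) @[n --> \oo] --> (pi / 2 : R).
  have /cvg_pinftyP : sine_integral (x - a) T @[T --> +oo] --> (pi / 2 : R).
    by apply: sine_integral_cvg; rewrite subr_gt0.
  exact.
have E n : \int[mu]_(t in `[a, b]) (h t * dirichlet_kernel (u n) (x - t)) =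
  \int[mu]_(y in `[h a, h b]) slice (u n) y +
   h a * (sine_integral (b - x) (u n) + sine_integral (x - a) (u n)).
  rewrite -(slice_fubini (u n)).1 -Rintegral_dirichlet_kernel ?(ltW ab)//.
  have ki := dirichlet_kernel_integrable a b x (u n).
  rewrite -RintegralZl//; last exact: Leb_measurable_itv.
  rewrite -RintegralD//; last 3 first.
  - exact: Leb_measurable_itv.
  - apply: (@integrable_mulr_bounded _ _ _ mu _ _ _ (h b - h a) (Leb_measurable_itv _) ki).
      by apply: measurable_funB; [exact: measurable_funTS|exact: measurable_cst].
    move=> t /=; rewrite in_itv/= => /andP[at_ tb].
    by rewrite ger0_norm ?subr_ge0 ?hmono// lerB ?hmono.
  - exact: (integrableZl (Leb_measurable_itv _) (h a) ki).
  by apply: eq_Rintegral => t _; ring.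
under eq_fun do rewrite E.
rewrite (_ : pi / 2 * (L + r) = pi / 2 * (L - h a + (r - h a)) +
  h a * (pi / 2 + pi / 2)); last by field.
by apply: cvgD => //; apply: cvgM; [exact: cvg_cst|exact: cvgD].
Qed.

End dirichlet_jordan.

(** * Exchanging the two Fourier integrals *)

Section fourier_exchange.
Context {R : realType}.
Local Notation mu := (@Leb R).
Implicit Types (A B s t x : R).

Lemma Rintegral_exchange_cos (D : set R) (g : R -> R) (x q A B : R) :
  measurable (D : set (LebT R)) -> mu.-integrable D (EFin \o g) ->
  \int[mu]_(t in D) (g t * \int[mu]_(s in `[A, B]) cos ((x - t) * s + q)) =
  \int[mu]_(s in `[A, B]) \int[mu]_(t in D) (g t * cos ((x - t) * s + q)).
Proof.
move=> mD gi.
have [] := @Rintegral_fubini_bounded _ _ (LebT R) (LebT R) R mu mu D `[A, B] g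
  (fun z => cos ((x - (z.1 : R)) * (z.2 : R) + q)) 1
  mD (Leb_measurable_itv _) (Leb_itv_fin _ _) gi.
- exact: measurable_cos_prod.
- by move=> s y _ _; exact: normr_cos_le1.
by move=> E _; exact: E.
Qed.

Lemma cos_subpihalf (y : R) : cos (y - pi / 2) = sin y.
Proof. by rewrite cosB cos_pihalf sin_pihalf mulr0 mulr1 add0r. Qed.

Lemma sin_subpihalf (y : R) : sin (y - pi / 2) = - cos y.
Proof. by rewrite sinB cos_pihalf sin_pihalf mulr0 mulr1 sub0r. Qed.

Lemma integrable_mulr_cos (D : set R) (g : R -> R) (c q : R) :
  measurable (D : set (LebT R)) -> mu.-integrable D (EFin \o g) ->
  mu.-integrable D (EFin \o (fun t => g t * cos (c * t + q))).
Proof.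
move=> mD gi; apply: (@integrable_mulr_bounded _ _ _ mu D g _ 1 mD gi).
  by apply: Leb_continuous_measurable; exact: continuous_cos_affine.
by move=> t _; exact: normr_cos_le1.
Qed.

(** The sine is written as a cosine with phase [-pi/2], so that the real and
    imaginary parts are instances of the same lemmas. *)
Lemma cintegral_exchange (D : set R) (g : R -> R) (x A B : R) :
  measurable (D : set (LebT R)) -> mu.-integrable D (EFin \o g) ->
  \cint_(s in `[A, B]) (expi (x * s) *
      \cint_(t in D) (expi (- (s * t)) * (g t)%:C%C)) =
  Complex (\int[mu]_(t in D) (g t * \int[mu]_(s in `[A, B]) cos ((x - t) * s + 0)))
    (\int[mu]_(t in D) (g t * \int[mu]_(s in `[A, B]) cos ((x - t) * s + - (pi / 2)))).
Proof.
move=> mD gi.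
have ReE s : \int[mu]_(t in D) complex.Re (expi (- (s * t)) * (g t)%:C%C) =
    \int[mu]_(t in D) (g t * cos (s * t + 0)).
  by apply: eq_Rintegral => t _ /=; rewrite mulr0 subr0 cosN addr0 mulrC.
have ImE s : \int[mu]_(t in D) complex.Im (expi (- (s * t)) * (g t)%:C%C) =
    - \int[mu]_(t in D) (g t * cos (s * t + - (pi / 2))).
  rewrite -mulN1r -RintegralZl//; last exact: integrable_mulr_cos.
  apply: eq_Rintegral => t _ /=.
  by rewrite mulr0 add0r sinN cos_subpihalf mulN1r mulNr mulrC.
rewrite /cintegral; congr Complex.
  rewrite Rintegral_exchange_cos//; apply: eq_Rintegral => s _ /=.
  rewrite ReE ImE mulrN opprK -!RintegralZl//; try exact: integrable_mulr_cos.
  rewrite -RintegralD//; last 2 first.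
  - exact: (integrableZl mD _ (integrable_mulr_cos _ _ mD gi)).
  - exact: (integrableZl mD _ (integrable_mulr_cos _ _ mD gi)).
  apply: eq_Rintegral => t _; rewrite !addr0 cos_subpihalf mulrBl cosB (mulrC t).
  by ring.
rewrite Rintegral_exchange_cos//; apply: eq_Rintegral => s _ /=.
rewrite ReE ImE mulrN -!RintegralZl//; try exact: integrable_mulr_cos.
rewrite addrC -RintegralB//; last 2 first.
- exact: (integrableZl mD _ (integrable_mulr_cos _ _ mD gi)).
- exact: (integrableZl mD _ (integrable_mulr_cos _ _ mD gi)).
apply: eq_Rintegral => t _; rewrite !addr0 !cos_subpihalf mulrBl sinB (mulrC t).
by ring.
Qed.

Lemma Rintegral_cos_sym T c : 0 <= T ->
  \int[mu]_(s in `[- T, T]) cos (c * s + 0) = 2 * dirichlet_kernel T c.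
Proof.
move=> T0; have TT : - T <= T by rewrite (le_trans _ T0)// oppr_le0.
rewrite /dirichlet_kernel.
have [->|c0] := eqVneq c 0.
  under eq_Rintegral do rewrite mul0r addr0 cos0.
  under [in RHS]eq_Rintegral do rewrite mul0r cos0.
  by rewrite !Rintegral_Leb_cst//; ring.
rewrite Rintegral_cos_affine//.
under [in RHS]eq_Rintegral do rewrite -[X in cos X]addr0.
rewrite Rintegral_cos_affine// !addr0 mulr0 sin0 mulrN sinN.
by field.
Qed.

Lemma Rintegral_sin_sym T c : 0 <= T ->
  \int[mu]_(s in `[- T, T]) cos (c * s + - (pi / 2)) = 0.
Proof.
move=> T0; have TT : - T <= T by rewrite (le_trans _ T0)// oppr_le0.
have [->|c0] := eqVneq c 0.
  under eq_Rintegral do rewrite mul0r cos_subpihalf sin0.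
  by rewrite Rintegral_Leb_cst// mul0r.
by rewrite Rintegral_cos_affine// !sin_subpihalf mulrN cosN subrr mul0r.
Qed.

(** The inner integral equals the difference of [sin((x-t)s + q)] at [s = B] and
    [s = A], divided by [x - t].  Since [|x - t| >= d] on the support of [g], the
    quotient [g(t)/(x-t)] is integrable and the Riemann-Lebesgue lemma applies at
    each endpoint separately, which is why [A] and [B] may vary independently. *)
Lemma tail_oscillation (E : set R) (g : R -> R) (x d q : R) :
  measurable (E : set (LebT R)) -> mu.-integrable setT (EFin \o g) -> 0 < d ->
  (forall t, E t -> d <= `|x - t|) -> (forall t, ~ E t -> g t = 0) ->
  forall e, 0 < e -> exists M, forall A B, A <= B -> M <= `|A| -> M <= `|B| ->
  `|\int[mu]_t (g t * \int[mu]_(s in `[A, B]) cos ((x - t) * s + q))| <= e.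
Proof.
move=> mE gi d0 dE gE e e0.
(* cutting with [E] keeps the factor [1/(x-t)] bounded on the whole line *)
pose w t := (x - t)^-1 * \1_E t.
have ki : mu.-integrable setT (EFin \o (fun t => g t * w t)).
  apply: (@integrable_mulr_bounded _ _ _ mu setT g w d^-1 measurableT gi).
    apply: measurable_funM; last exact: measurable_indic.
    apply: (measurableT_comp measurable_inv_real).
    apply: measurable_funB; first exact: measurable_cst.
    exact: Leb_id_measurable.
  move=> t _; rewrite /w indicE; have [Et|nEt] := pselect (E t).
    rewrite mem_set// mulr1 normfV lef_pV2 ?posrE ?dE//.
    exact: lt_le_trans (dE _ Et).
  by rewrite memNset// mulr0 normr0 invr_ge0 ltW.
have [_ /(_ (e / 2))[|M hM]] := riemann_lebesgue ki; first by rewrite divr_gt0.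
exists M => A B AB MA MB.
have osc C : M <= `|C| ->
    `|\int[mu]_t (g t * w t * cos ((- C) * t + (x * C + q - pi / 2)))| <= e / 2.
  by move=> MC; apply: hM; rewrite normrN.
rewrite (_ : \int[mu]_t _ =
    \int[mu]_t (g t * w t * cos ((- B) * t + (x * B + q - pi / 2))) -
    \int[mu]_t (g t * w t * cos ((- A) * t + (x * A + q - pi / 2)))).
  by rewrite (splitr e); apply: le_trans (ler_normB _ _) _; apply: lerD; exact: osc.
rewrite -RintegralB//; [|exact: integrable_osc|exact: integrable_osc].
apply: eq_Rintegral => t _.
have [Et|nEt] := pselect (E t); last by rewrite gE// !mul0r subrr.
have xt0 : x - t != 0 by rewrite -normr_gt0 (lt_le_trans d0)// dE.
rewrite Rintegral_cos_affine// /w indicE mem_set// mulr1 -mulrBr -mulrA.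
congr (_ * _).
have sE C : cos (- C * t + (x * C + q - pi / 2)) = sin ((x - t) * C + q).
  by rewrite -cos_subpihalf; congr cos; ring.
by rewrite !sE mulrC.
Qed.

End fourier_exchange.

(** * Convergence of complex-valued functions *)

Section complex_cvg.
Context {R : realType}.

Lemma normc_le (u v : R) : `|Complex u v| <= (`|u| + `|v|)%:C%C.
Proof.
rewrite normc_def lecE/= eqxx/=.
have uv0 : 0 <= `|u| + `|v| by rewrite addr_ge0.
rewrite -[leRHS](ger0_norm uv0) -sqrtr_sqr; apply: ler_wsqrtr.
rewrite -(real_normK (num_real u)) -(real_normK (num_real v)) sqrrD.
by rewrite lerD2r lerDl mulrn_wge0// mulr_ge0.
Qed.

Lemma cvg_Complex (T : Type) (F : set_system T) {FF : Filter F} (u v : T -> R)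
    (a b : R) : u t @[t --> F] --> a -> v t @[t --> F] --> b ->
  (Complex (u t) (v t) : R[i]^o) @[t --> F] --> (Complex a b : R[i]^o).
Proof.
move=> /cvgrPdist_le ua /cvgrPdist_le vb; apply/cvgrPdist_le => e.
rewrite ltcE/= => /andP[/eqP e0 e1].
have e2 : 0 < complex.Re e / 2 by rewrite divr_gt0.
near=> t.
have -> : (Complex a b : R[i]^o) - Complex (u t) (v t) = Complex (a - u t) (b - v t) by [].
apply: le_trans (normc_le _ _) _.
rewrite lecE/= e0 eqxx/= (splitr (complex.Re e)); apply: lerD.
  by near: t; exact: ua.
by near: t; exact: vb.
Unshelve. all: by end_near. Qed.

Lemma cvg_Complex0 (T : Type) (F : set_system T) {FF : Filter F} (u v : T -> R) :
  u t @[t --> F] --> (0 : R) -> v t @[t --> F] --> (0 : R) ->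
  (Complex (u t) (v t) : R[i]^o) @[t --> F] --> (0 : R[i]^o).
Proof.
exact: cvg_Complex.
Qed.

End complex_cvg.

(** * Functions of bounded variation *)

Section bounded_variation_parts.
Context {R : realType}.
Local Notation mu := (@Leb R).

(** The Jordan parts are monotone on [[a, b]] only; precomposing them with the
    projection onto [[a, b]] makes them monotone, hence Borel, on the whole
    line. *)
Lemma bounded_variation_monotone_parts (a b : R) (f : R -> R) : a < b ->
  bounded_variation a b f ->
  exists h1 h2 : R -> R, [/\ {homo h1 : s t / s <= t}, {homo h2 : s t / s <= t} &
    forall t, a <= t <= b -> f t = h1 t - h2 t].
Proof.
move=> ab bv.
pose clamp t := Num.max a (Num.min t b).
have clampP t : clamp t \in `[a, b].
  by rewrite in_itv/= le_max lexx/= ge_max (ltW ab)/= ge_min lexx orbT.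
have clamp_homo : {homo clamp : s t / s <= t}.
  by move=> s t st; rewrite /clamp; apply: le_max2 => //; exact: le_min2.
have clampE t : a <= t <= b -> clamp t = t.
  by move=> /andP[at_ tb]; rewrite /clamp min_l// max_r.
exists (fun t => fine (pos_tv a f (clamp t))),
  (fun t => fine (neg_tv a f (clamp t))); split.
- move=> s t st.
  apply: (fine_neg_tv_nondecreasing (bounded_variationN bv)) => //.
  exact: clamp_homo.
- move=> s t st; apply: (fine_neg_tv_nondecreasing bv) => //.
  exact: clamp_homo.
- move=> t abt; rewrite clampE//.
  by rewrite (bounded_variation_pos_neg_tvE bv)//= in_itv.
Qed.

(** The order-theoretic form of the one-sided limit, as a supremum approached
    arbitrarily close to [x], is what locates the superlevel sets of [h]. *)
Lemma nondecreasing_cvg_left (h : R -> R) (x : R) : {homo h : s t / s <= t} ->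
  exists L, [/\ h t @[t --> x^'-] --> L, forall t, t < x -> h t <= L &
    forall c y, c < x -> y < L -> exists2 t, c <= t < x & y < h t].
Proof.
move=> hmono.
have cvgh : cvg (h t @[t --> x^'-]).
  apply: nondecreasing_at_left_is_cvgr.
    by near=> t; move=> u v _ _; exact: hmono.
  near=> t; exists (h x) => _ [u + <-]; rewrite /= in_itv/= => /andP[_ ux].
  exact/hmono/ltW.
exists (lim (h t @[t --> x^'-])); split => //.
- move=> t tx; apply: limr_ge => //; near=> u; apply/hmono/ltW.
  by near: u; exact: nbhs_left_gt.
- move=> c y cx yL; near (x^'-) => u; exists u.
    apply/andP; split; last by near: u; exact: nbhs_left_lt.
    by near: u; exact: nbhs_left_ge.
  by near: u; exact: (cvgr_gt _ cvgh).
Unshelve. all: by end_near. Qed.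

Lemma nondecreasing_cvg_right (h : R -> R) (x : R) : {homo h : s t / s <= t} ->
  exists L, [/\ h t @[t --> x^'+] --> L, forall t, x < t -> L <= h t &
    forall c y, x < c -> L < y -> exists2 t, x < t <= c & h t < y].
Proof.
move=> hmono.
have cvgh : cvg (h t @[t --> x^'+]).
  apply: nondecreasing_at_right_is_cvgr.
    by near=> t; move=> u v _ _; exact: hmono.
  near=> t; exists (h x) => _ [u + <-]; rewrite /= in_itv/= => /andP[ux _].
  exact/hmono/ltW.
exists (lim (h t @[t --> x^'+])); split => //.
- move=> t tx; apply: limr_le => //; near=> u; apply/hmono/ltW.
  by near: u; exact: nbhs_right_lt.
- move=> c y cx yL; near (x^'+) => u; exists u.
    apply/andP; split; first by near: u; exact: nbhs_right_gt.
    by near: u; exact: nbhs_right_le.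
  by near: u; exact: (cvgr_lt _ cvgh).
Unshelve. all: by end_near. Qed.

Lemma dirichlet_jordan_monotone (a b x : R) (h : R -> R) : a < x < b ->
  {homo h : s t / s <= t} -> exists L r,
  [/\ h t @[t --> x^'-] --> L, h t @[t --> x^'+] --> r &
    \int[mu]_(t in `[a, b]) (h t * dirichlet_kernel T (x - t)) @[T --> +oo] -->
      pi / 2 * (L + r)].
Proof.
move=> axb hmono; have /andP[ax xb] := axb.
have [L [cL hL hL']] := nondecreasing_cvg_left x hmono.
have [r [cr hr hr']] := nondecreasing_cvg_right x hmono.
exists L, r; split => //.
by apply: dirichlet_jordan_nondecreasing => // y yL; [exact: hL'|exact: hr'].
Qed.

Lemma nondecreasing_integrable_itv (a b : R) (h : R -> R) :
  {homo h : s t / s <= t} -> mu.-integrable `[a, b] (EFin \o h).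
Proof.
move=> hmono; apply: (@Leb_integrable_bounded_itv _ _ _ (`|h a| + `|h b|)).
  by apply: measurable_fun_Leb; exact: nondecreasing_measurable.
move=> t /andP[/hmono hat /hmono htb]; rewrite ler_norml; apply/andP; split.
  apply: (le_trans _ hat); rewrite lerNl.
  by apply: (@le_trans _ _ `|h a|); rewrite ?lerDl// -normrN ler_norm.
apply: (le_trans htb).
by apply: (@le_trans _ _ `|h b|); rewrite ?lerDr// ler_norm.
Qed.

Theorem dirichlet_jordan (a b x : R) (f : R -> R) : a < x < b ->
  bounded_variation a b f -> exists L r,
  [/\ mu.-integrable `[a, b] (EFin \o f),
    f t @[t --> x^'-] --> L, f t @[t --> x^'+] --> r &
    \int[mu]_(t in `[a, b]) (f t * dirichlet_kernel T (x - t)) @[T --> +oo] -->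
      pi / 2 * (L + r)].
Proof.
move=> axb bv; have /andP[ax xb] := axb.
have [h1 [h2 [m1 m2 fE]]] := bounded_variation_monotone_parts (lt_trans ax xb) bv.
have [L1 [r1 [cL1 cr1 cI1]]] := dirichlet_jordan_monotone axb m1.
have [L2 [r2 [cL2 cr2 cI2]]] := dirichlet_jordan_monotone axb m2.
have i1 := nondecreasing_integrable_itv a b m1.
have i2 := nondecreasing_integrable_itv a b m2.
have mab : measurable (`[a, b] : set (LebT R)) by exact: Leb_measurable_itv.
exists (L1 - L2), (r1 - r2); split.
- apply: (@eq_integrable _ _ _ mu `[a, b] mab (EFin \o (fun t => h1 t - h2 t))).
    by move=> t; rewrite inE/= in_itv/= => abt; rewrite /= fE.
  exact: (integrableB mab i1 i2).
- apply: (@cvg_trans _ ((h1 t - h2 t) @[t --> x^'-])); last exact: cvgB.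
  apply: near_eq_cvg; near=> t; apply: esym; apply: fE; apply/andP; split.
    by near: t; exact: nbhs_left_ge.
  by apply: (le_trans _ (ltW xb)); near: t; exact: nbhs_left_le.
- apply: (@cvg_trans _ ((h1 t - h2 t) @[t --> x^'+])); last exact: cvgB.
  apply: near_eq_cvg; near=> t; apply: esym; apply: fE; apply/andP; split.
    by apply: (le_trans (ltW ax)); near: t; exact: nbhs_right_ge.
  by near: t; exact: nbhs_right_le.
have kM T t : `|dirichlet_kernel T (x - t)| <= `|T| by exact: normr_dirichlet_kernel.
have mk T : measurable_fun (`[a, b] : set (LebT R)) (fun t => dirichlet_kernel T (x - t)).
  by have /(measurable_int mu)/measurable_EFinP := dirichlet_kernel_integrable a b x T.
have E T : \int[mu]_(t in `[a, b]) (f t * dirichlet_kernel T (x - t)) =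
    \int[mu]_(t in `[a, b]) (h1 t * dirichlet_kernel T (x - t)) -
    \int[mu]_(t in `[a, b]) (h2 t * dirichlet_kernel T (x - t)).
  rewrite -RintegralB//.
  - apply: eq_Rintegral => t; rewrite inE/= in_itv/= => abt.
    by rewrite fE// mulrBl.
  - exact: (@integrable_mulr_bounded _ _ _ mu _ _ _ `|T| mab i1 (mk T)).
  - exact: (@integrable_mulr_bounded _ _ _ mu _ _ _ `|T| mab i2 (mk T)).
under eq_fun do rewrite E.
rewrite (_ : _ * _ = pi / 2 * (L1 + r1) - pi / 2 * (L2 + r2)); last by ring.
exact: cvgB.
Unshelve. all: by end_near. Qed.

End bounded_variation_parts.

(** * The inversion formula *)

Unset Implicit Arguments.
Set Strict Implicit.

Local Open Scope complex_scope.

Theorem corollary3p4 (R : realType) (a b : R) (ab : a < b) (f : R -> R)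
    (bvf : bounded_variation a b f)
    (fl : in_L1 `]-oo, a] f) (fr : in_L1 `[b, +oo[ f)
    (x : R) (axb : a < x < b) :
  let I (T : R) : R[i]^o :=
    \cint_(s in `[- T, T]) (expi (x * s) *
      \cint_(t in `[a, b]) (expi (- (s * t)) * (f t)%:C)) in
  let E : set R := `]-oo, a] `|` `[b, +oo[ in
  let J (A B : R) : R[i]^o :=
    \cint_(s in `[A, B]) (expi (x * s) *
      \cint_(t in setT) (expi (- (s * t)) * (f t * \1_E t)%:C)) in
  [/\ cvg (f t @[t --> x^'-]) /\ cvg (f t @[t --> x^'+]),
      cvg (I T @[T --> +oo]),
      ((lim (f t @[t --> x^'-]) + lim (f t @[t --> x^'+])) / 2)%:C =
        (1 / (2 * pi))%:C * lim (I T @[T --> +oo])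
    & J AB.1 AB.2 @[AB --> filter_prod -oo +oo] --> (0 : R[i]^o)].
Proof.
move=> I E J; have /andP[ax xb] := axb.
have [L [r [fi cL cr cI]]] := dirichlet_jordan axb bvf.
have mab : measurable (`[a, b] : set (LebT R)) by exact: Leb_measurable_itv.
have cvgI : I T @[T --> +oo] --> (Complex (pi * (L + r)) 0 : R[i]^o).
  apply: (@cvg_trans _ ((Complex (2 *
      \int[@Leb R]_(t in `[a, b]) (f t * dirichlet_kernel T (x - t))) 0 : R[i]^o)
      @[T --> +oo])).
    apply: near_eq_cvg; near=> T.
    have T0 : 0 <= T by near: T; apply: nbhs_pinfty_ge; exact: num_real.
    rewrite /I cintegral_exchange//; congr Complex.
      rewrite -RintegralZl//; last first.
        apply: (@integrable_mulr_bounded _ _ _ (@Leb R) _ _ _ `|T| mab fi).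
          by have /(measurable_int (@Leb R))/measurable_EFinP :=
            dirichlet_kernel_integrable a b x T.
        by move=> t _; exact: normr_dirichlet_kernel.
      by apply: eq_Rintegral => t _; rewrite Rintegral_cos_sym//; ring.
    under eq_Rintegral do rewrite Rintegral_sin_sym// mulr0.
    by rewrite Rintegral_Leb_cst ?mul0r// ltW.
  apply: cvg_Complex; last exact: cvg_cst.
  rewrite (_ : pi * (L + r) = 2 * (pi / 2 * (L + r))); last by field.
  by apply: cvgM => //; exact: cvg_cst.
split.
- by split; apply/cvg_ex; [exists L|exists r].
- by apply/cvg_ex; eexists; exact: cvgI.
- rewrite (cvg_lim _ cL)// (cvg_lim _ cr)// (cvg_lim _ cvgI)//.
  rewrite -[Complex (pi * (L + r)) 0]/((pi * (L + r))%:C) -rmorphM; congr (_%:C).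
  have : pi != 0 :> R by rewrite gt_eqF ?pi_gt0.
  by move: (pi : R) => p p0; field.
have Eunion (t : R) : f t * \1_E t = f t * \1_`]-oo, a] t + f t * \1_`[b, +oo[ t.
  rewrite -mulrDr !indicE in_setU; congr (_ * _).
  have [ta|_] := boolP (t \in `]-oo, a]%classic); last by rewrite add0r.
  rewrite [t \in _](_ : _ = false) ?addr0//; apply/negP => /set_mem tb.
  move/set_mem : ta; move: tb; rewrite /= !in_itv/= andbT => bt ta.
  by have := le_trans bt ta; rewrite leNgt ab.
have gi : (@Leb R).-integrable setT (EFin \o (fun t => f t * \1_E t)).
  apply: (@eq_integrable _ _ _ (@Leb R) setT measurableT
    (EFin \o (fun t => f t * \1_`]-oo, a] t + f t * \1_`[b, +oo[ t))).
    by move=> t _; rewrite /= Eunion.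
  exact: (integrableD measurableT (integrable_restrict (Leb_measurable_itv _) fl)
    (integrable_restrict (Leb_measurable_itv _) fr)).
have mE : measurable (E : set (LebT R)).
  by apply: measurableU; exact: Leb_measurable_itv.
pose d := Num.min (x - a) (b - x).
have d0 : 0 < d by rewrite lt_min !subr_gt0 ax.
have dE t : E t -> d <= `|x - t|.
  rewrite /E/= !in_itv/= andbT => -[ta|bt]; rewrite /d ge_min.
    by rewrite (le_trans _ (ler_norm _))// lerB.
  apply/orP; right; rewrite -normrN opprB.
  by apply: (le_trans _ (ler_norm _)); exact: lerB.
have gE t : ~ E t -> f t * \1_E t = 0 by move=> nE; rewrite indicE memNset// mulr0.
pose K q (AB : R * R) : R := \int[@Leb R]_t (f t * \1_E t *
  \int[@Leb R]_(s in `[AB.1, AB.2]) cos ((x - t) * s + q)).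
have cvgK q : K q AB @[AB --> filter_prod -oo +oo] --> (0 : R).
  apply/cvgrPdist_le => e e0; rewrite /=.
  have [M hM] := tail_oscillation q mE gi d0 dE gE e0.
  exists ([set A | A <= - `|M|], [set B | `|M| <= B]) => /=.
    split; first by apply: nbhs_ninfty_le; exact: num_real.
    by apply: nbhs_pinfty_ge; exact: num_real.
  move=> [A B] /= [AM BM].
  rewrite sub0r normrN; apply: hM.
  - by apply: (le_trans AM); apply: (le_trans _ BM); rewrite ge0_cp.
  - apply: (le_trans (ler_norm M)); rewrite -[leRHS]normrN.
    by apply: (le_trans _ (ler_norm _)); rewrite lerNr.
  - by apply: (le_trans (ler_norm M)); apply: (le_trans BM); exact: ler_norm.
have JE : (fun AB : R * R => J AB.1 AB.2) =
    fun AB => Complex (K 0 AB) (K (- (pi / 2)) AB).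
  by apply/funext => -[A B]; rewrite /J cintegral_exchange.
rewrite JE; move: K cvgK {JE} => K cvgK.
by apply: cvg_Complex0; exact: cvgK.
Unshelve. all: by end_near. Qed.
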